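(* Let $\Omega\subset\mathbb{Q}_p$ be a $p$-homogeneous compact open set with $\mathfrak{m}(\Omega)>0$, and let $I_\Omega$ be its set of admissible $p$-orders. (a) The set $\Lambda_0=\sum_{i\in I_\Omega}(\mathbb{Z}/p\mathbb{Z})\cdot p^{-i-1}$ is a spectrum of $\Omega$. Moreover, a set $\Lambda\subset\mathbb{Q}_p$ is a spectrum of $\Omega$ if and only if $\Lambda=f(\Lambda_0)$ for some isometric bijection $f:\mathbb{Q}_p\to\mathbb{Q}_p$. (b) The set $T_0=\sum_{i\in\mathbb{Z}\setminus I_\Omega}(\mathbb{Z}/p\mathbb{Z})\cdot p^{i}$ is a tiling complement of $\Omega$. Moreover, a set $T\subset\mathbb{Q}_p$ is a tiling complement of $\Omega$ if and only if $T=f(T_0)$ for some isometric bijection $f:\mathbb{Q}_p\to\mathbb{Q}_p$.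
   Context: $p\ge2$ is a prime. $\mathbb{Q}_p$ and $\mathbb{Z}_p$ are the $p$-adic numbers and $p$-adic integers, with valuation $v_p$ and $|x|_p=p^{-v_p(x)}$. $\mathfrak{m}$ is the Haar measure with $\mathfrak{m}(\mathbb{Z}_p)=1$. Balls are $B(a,p^n)=a+p^{-n}\mathbb{Z}_p$. Characters: $\chi(x)=e^{2\pi i\{x\}}$, where $\{x\}=\sum_{n=v_p(x)}^{-1}a_np^n$ is the fractional part of $x=\sum_{n\ge v_p(x)}a_np^n$ with digits $a_n\in\{0,\dots,p-1\}$. Also $\chi_y(x)=\chi(yx)$. Spectrum: $\Lambda$ is a spectrum of $\Omega$ if $\{\chi_\lambda|_\Omega\}_{\lambda\in\Lambda}$ is an orthonormal basis of $L^2(\mathfrak{m}|_\Omega/\mathfrak{m}(\Omega))$. Tiling complement: $T$ is a tiling complement of $\Omega$ if $\sum_{t\in T}1_\Omega(x-t)=1$ for a.e. $x\in\mathbb{Q}_p$. Admissible $p$-orders: for $E\subset\mathbb{Q}_p$, $I_E=\{v_p(x-y): x,y\in E,\ x\neq y\}$. Sum notation: $(\mathbb{Z}/p\mathbb{Z})\cdot p^i=\{ap^i: a\in\{0,1,\dots,p-1\}\}$. For sets $A_i\ni 0$, $\sum_{i\in I}A_i$ is the set of all finite sums $\sum_{i\in J}a_i$ with $J\subset I$ finite and $a_i\in A_i$. $p$-homogeneity of a compact open set: let $\mathcal{N}_n(\Omega)$ be the set of balls of radius $p^{-n}$ meeting $\Omega$. $\Omega$ is $p$-homogeneous if for each $n\in\mathbb{Z}$,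 either every ball of $\mathcal{N}_n(\Omega)$ contains exactly one ball of $\mathcal{N}_{n+1}(\Omega)$, or every ball of $\mathcal{N}_n(\Omega)$ contains exactly $p$ balls of $\mathcal{N}_{n+1}(\Omega)$. *)

(* Defs.v *)
From HB Require Import structures.
From Stdlib Require Import ClassicalEpsilon ProofIrrelevance FunctionalExtensionality.
From mathcomp Require Import all_boot all_order all_algebra.
From mathcomp Require Import all_classical all_reals all_analysis.
Set Implicit Arguments. Unset Strict Implicit. Unset Printing Implicit Defensive.
Import Order.TTheory GRing.Theory Num.Theory.
Local Open Scope classical_set_scope.
Local Open Scope ring_scope.
Local Open Scope card_scope.

Section Qp.
Variable p : nat.
Hypothesis p_gt0 : (0 < p)%N.

(* digit expansions x = sum_{n >= v} a_n p^n, digits a_n in {0..p-1} *)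
Definition qp_valid (d : int -> nat) :=
  (forall n, (d n < p)%N) /\ exists N : int, forall n, n < N -> d n = 0%N.

(* the parameter h only records that p > 0 (p prime in the application) *)
Record QP_ (h : (0 < p)%N) := MkQP { digit : int -> nat; digitP : qp_valid digit }.
Local Notation QP := (QP_ p_gt0).

HB.instance Definition _ := gen_eqMixin QP.
HB.instance Definition _ := gen_choiceMixin QP.

Lemma qp_zero_valid : qp_valid (fun _ => 0%N).
Proof. by split=> //; exists 0%R. Qed.
Definition qp_zero : QP := @MkQP p_gt0 _ qp_zero_valid.
HB.instance Definition _ := isPointed.Build QP qp_zero.

Definition lb (x : QP) : int :=
  epsilon (inhabits 0) (fun N => forall n, n < N -> digit x n = 0%N).

Fixpoint add_carry (x y : int -> nat) (N : int) (k : nat) : nat :=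
  if k is k'.+1 then
    let j : int := N + k'%:Z in
    (x j + y j + add_carry x y N k')%N %/ p
  else 0%N.

Definition add_raw (x y : int -> nat) (N : int) (n : int) : nat :=
  if (n < N)%R then 0%N else let k := absz (n - N)%R in ((x n + y n + add_carry x y N k) %% p)%N.

Lemma add_raw_valid x y N : qp_valid (add_raw x y N).
Proof.
split=> [n|]; first by rewrite /add_raw; case: ifP => // _; rewrite ltn_pmod.
by exists N => n hn; rewrite /add_raw hn.
Qed.

Definition qp_add (x y : QP) : QP :=
  @MkQP p_gt0 _ (add_raw_valid (digit x) (digit y) (Num.min (lb x) (lb y))).

Definition conv (x y : int -> nat) (Nx Ny : int) (k : nat) : nat :=
  \sum_(i < k.+1) (x (Nx + i%:Z)%R * y (Ny + (k - i)%N%:Z)%R)%N.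

Fixpoint mul_carry (x y : int -> nat) (Nx Ny : int) (k : nat) : nat :=
  if k is k'.+1 then (conv x y Nx Ny k' + mul_carry x y Nx Ny k')%N %/ p
  else 0%N.

Definition mul_raw (x y : int -> nat) (Nx Ny : int) (n : int) : nat :=
  if (n < Nx + Ny)%R then 0%N
  else let k := absz (n - (Nx + Ny))%R in
    ((conv x y Nx Ny k + mul_carry x y Nx Ny k) %% p)%N.

Lemma mul_raw_valid x y Nx Ny : qp_valid (mul_raw x y Nx Ny).
Proof.
split=> [n|]; first by rewrite /mul_raw; case: ifP => // _; rewrite ltn_pmod.
by exists (Nx + Ny)%R => n hn; rewrite /mul_raw hn.
Qed.

Definition qp_mul (x y : QP) : QP :=
  @MkQP p_gt0 _ (mul_raw_valid (digit x) (digit y) (lb x) (lb y)).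

Definition qp_sub (x y : QP) : QP :=
  epsilon (inhabits qp_zero) (fun z => qp_add z y = x).

Lemma mono_valid (a : 'I_p) (k : int) :
  qp_valid (fun n => if n == k then nat_of_ord a else 0%N).
Proof.
split=> [n|]; first by case: ifP.
by exists k => n hn; rewrite lt_eqF.
Qed.
Definition qp_mono (a : 'I_p) (k : int) : QP := @MkQP p_gt0 _ (mono_valid a k).

(* p-adic valuation (for x <> 0) and absolute value |x|_p (a rational) *)
Definition vp (x : QP) : int :=
  epsilon (inhabits 0) (fun v => digit x v <> 0%N /\ forall n, n < v -> digit x n = 0%N).

Definition absp (x : QP) : rat :=
  if x == qp_zero then 0 else (p%:R : rat) ^ (- vp x).

(* fractional part {x} = sum_{n = v_p(x)}^{-1} a_n p^n (a rational) *)
Definition frac (x : QP) : rat :=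
  \sum_(k < `|Num.min (lb x) 0|%N)
     ((digit x (lb x + k%:Z))%:R * (p%:R : rat) ^ (lb x + k%:Z)).

Definition qp_ball (a : QP) (n : int) : set QP :=
  [set x | absp (qp_sub x a) <= (p%:R : rat) ^ (- n)].

Definition qp_balls : set (set QP) := [set B | exists a n, B = qp_ball a n].

Definition QPm := g_sigma_algebraType qp_balls.

(* Haar measure normalized by m(Z_p) = 1 : m(a + p^n Z_p) = p^(-n) *)
Definition haar_measure (R : realType) (m : set QPm -> \bar R) :=
  forall (a : QP) (n : int), m (qp_ball a n) = ((p%:R : R) ^ (- n))%:E.

Definition qp_open (U : set QP) :=
  forall x, U x -> exists n : int, qp_ball x n `<=` U.

Definition qp_compact (K : set QP) :=
  forall (I : Type) (U : I -> set QP), (forall i, qp_open (U i)) ->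
    K `<=` \bigcup_(i in setT) U i ->
    exists F : set I, finite_set F /\ K `<=` \bigcup_(i in F) U i.

Definition Nballs (Om : set QP) (n : int) : set (set QP) :=
  [set B | exists a, B = qp_ball a n /\ B `&` Om !=set0].

Definition p_homogeneous (Om : set QP) :=
  forall n : int,
    (forall B, Nballs Om n B ->
       [set B' | Nballs Om (n + 1) B' /\ B' `<=` B] #= [set: 'I_1])
 \/ (forall B, Nballs Om n B ->
       [set B' | Nballs Om (n + 1) B' /\ B' `<=` B] #= [set: 'I_p]).

Definition adm_orders (E : set QP) : set int :=
  [set v | exists x y, E x /\ E y /\ x <> y /\ vp (qp_sub x y) = v].

Definition digit_sumset (I : set int) (e : int -> int) : set QP :=
  [set x | exists (s : seq int) (a : int -> 'I_p),
     uniq s /\ (forall i, i \in s -> I i) /\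
     x = foldr (fun i acc => qp_add (qp_mono (a i) (e i)) acc) qp_zero s].

Definition Lambda0 (Om : set QP) := digit_sumset (adm_orders Om) (fun i => - i - 1).
Definition T0 (Om : set QP) := digit_sumset (~` adm_orders Om) (fun i => i).

(* chi_l(x) = exp(2 pi i {l x}) = cos(theta l x) + i sin(theta l x) *)
Definition theta (R : realType) (l x : QP) : R := 2 * pi * ratr (frac (qp_mul l x)).

(* Lambda is a spectrum: {chi_l|_Om} is an orthonormal basis of
   L^2(m|_Om / m(Om)); complex values written via real/imag parts *)
Definition spectrum (R : realType) (m : {measure set QPm -> \bar R})
    (Om : set QPm) (Lam : set QPm) :=
  (forall l l', Lam l -> Lam l' ->
     (\int[m]_(x in Om) ((fine (m Om))^-1 * cos (theta R l x - theta R l' x))%:E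
        = (if l == l' then 1 else 0)%:E)%E /\
     (\int[m]_(x in Om) ((fine (m Om))^-1 * sin (theta R l x - theta R l' x))%:E
        = 0)%E)
  /\
  (forall u v : QPm -> R,
     measurable_fun Om u -> measurable_fun Om v ->
     m.-integrable Om (fun x => (u x ^+ 2)%:E) ->
     m.-integrable Om (fun x => (v x ^+ 2)%:E) ->
     (forall l, Lam l ->
        (\int[m]_(x in Om) (u x * cos (theta R l x) + v x * sin (theta R l x))%:E = 0)%E
        /\ (\int[m]_(x in Om) (v x * cos (theta R l x) - u x * sin (theta R l x))%:E = 0)%E) ->
     {ae m, forall x, Om x -> u x = 0 /\ v x = 0}).

Definition tiling_complement (R : realType) (m : {measure set QPm -> \bar R})
    (Om : set QPm) (T : set QPm) :=
  {ae m, forall x : QPm, (\esum_(t in T) (\1_Om (qp_sub x t) : R)%:E = 1)%E}.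

Definition isometric_bijection (f : QP -> QP) :=
  bijective f /\ forall x y, absp (qp_sub (f x) (f y)) = absp (qp_sub x y).

End Qp.

(* Main.v *)
(** Say that two digit expansions [agree] below [n] when their digits at all positions [< n] coincide; balls and
valuations of differences are read off this relation.  A set [S] is a tree with
set of orders [J] when two elements of [S] first differ at a position of [J],
and when at each position of [J] every element of [S] branches in all [p]
directions.  If [J] is bounded above, the trees with orders [J] are exactly the
isometric images of [{x | supp x \subset J}].  A [p]-homogeneous set is a tree for
[I = I_Omega], so both parts reduce to a characterization of trees: spectra are
the trees with orders [-I-1], tiling complements those with orders [~ I].

Spectra.  The sum of a character over the balls of [Omega] vanishes as soon as
the digit it detects branches, because shifting that digit multiplies the sum by
a nontrivial root of unity; conversely irreducibility of the cyclotomic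
polynomials of prime power order shows that a vanishing sum forces branching.
Hence orthogonality means that differences have orders in [-I-1].  Comparing the
indicator of a ball with its orthogonal projection counts the frequencies in a
large ball and forces saturation.  For the converse the roles of [Omega] and
[Lambda] are exchanged in the vanishing sums, which recovers indicators of balls
from characters.

Tilings.  By Tijdeman's argument ([A(X)^q = A(X^q)] modulo a prime [q]), a tiling
[A + B] of [Z/p^L] gives a tiling [k A + B] for each [k] prime to [p]; so a common
order of [Omega] and [T] would produce a collision, and counting gives
saturation. *)
Require Import Defs.
From HB Require Import structures.
From Stdlib Require Import ClassicalEpsilon ProofIrrelevance.
From mathcomp Require Import all_boot all_order all_algebra.
From mathcomp Require Import archimedean cyclotomic algC complex.
From mathcomp Require Import all_classical all_reals all_analysis.
From mathcomp Require Import measurable_realfun.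
From mathcomp Require Import zify ring lra.
Set Implicit Arguments. Unset Strict Implicit. Unset Printing Implicit Defensive.
Import Order.TTheory GRing.Theory Num.Theory.
Local Open Scope classical_set_scope.
Local Open Scope ring_scope.

(** * Digit arithmetic *)

(** Induction on the base position of an expansion. [qp_add] and [qp_mul] start from [lb], an
    arbitrary choice by [epsilon]; this carries a statement from there to any base [N] below which
    the arguments vanish. *)
Lemma int_updown (V P : int -> Prop) (N0 : int) :
  P N0 -> (forall N, P N -> P (N - 1)) ->
  (forall N, V N -> P (N - 1) -> P N) ->
  (forall N N', N <= N' -> V N' -> V N) -> forall N, V N -> P N.
Proof.
move=> P0 Pdown Pup Vle N VN.
have Pk (k : nat) : P (N0 - k%:Z).
  elim: k => [|k IH]; first by rewrite subr0.
  have -> : N0 - k.+1%:Z = N0 - k%:Z - 1 by lia.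
  exact: Pdown.
have [NN0|/ltW N0N] := leP N N0.
  by have -> : N = N0 - `|N0 - N|%N%:Z by lia.
have up (k : nat) : N0 + k%:Z <= N -> P (N0 + k%:Z).
  elim: k => [|k IH] h; first by rewrite addr0.
  apply: Pup; first exact: Vle VN.
  have -> : N0 + k.+1%:Z - 1 = N0 + k%:Z by lia.
  by apply: IH; lia.
have -> : N = N0 + `|(N - N0)%R|%N%:Z by lia.
by apply: up; lia.
Qed.

Section Arithmetic.
Variables (p : nat) (p_gt0 : (0 < p)%N).
Local Notation QP := (QP_ p_gt0).
Implicit Types (x y z : QP) (N n : int) (k : nat).

Lemma digit_lt x n : (digit x n < p)%N.
Proof. by case: x => d []. Qed.

Lemma qp_ext x y : digit x =1 digit y -> x = y.
Proof.
case: x y => [d dP] [e eP] /= /funext de.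
by move: dP eP; rewrite de => dP eP; rewrite (proof_irrelevance _ dP eP).
Qed.

Definition zero_below N x := forall j, j < N -> digit x j = 0%N.

Lemma zero_below_exists x : exists N, zero_below N x.
Proof. by case: x => d []. Qed.

Lemma lb_zero_below x : zero_below (lb x) x.
Proof. exact: (epsilon_spec (inhabits (0 : int)) (fun N => zero_below N x) (zero_below_exists x)). Qed.

Lemma zero_below_le N N' x : N <= N' -> zero_below N' x -> zero_below N x.
Proof. by move=> NN' h j jN; apply: h; exact: lt_le_trans NN'. Qed.

Lemma zero_below2 x y : exists N, zero_below N x /\ zero_below N y.
Proof.
have [N1 Nx] := zero_below_exists x; have [N2 Ny] := zero_below_exists y.
by exists (Num.min N1 N2); split; [apply: zero_below_le Nx|apply: zero_below_le Ny]; lia.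
Qed.

Definition agree n x y := forall j, j < n -> digit x j = digit y j.

Lemma agree_sym n x y : agree n x y -> agree n y x.
Proof. by move=> h j /h. Qed.

Lemma agree_trans n y x z : agree n x y -> agree n y z -> agree n x z.
Proof. by move=> h h' j jn; rewrite h ?h'. Qed.

Lemma agree_le n n' x y : n <= n' -> agree n' x y -> agree n x y.
Proof. by move=> nn' h j jn; apply: h; exact: lt_le_trans nn'. Qed.

Lemma agreeS n x y : agree n x y -> digit x n = digit y n -> agree (n + 1) x y.
Proof.
move=> h hn j jn; have [/h//|nj] := ltP j n.
by have -> : j = n by lia.
Qed.

Lemma agree_zero_below N n x y : N <= n -> agree n x y -> zero_below N x -> zero_below N y.
Proof. by move=> Nn h hx j jN; rewrite -h ?hx//; exact: lt_le_trans Nn. Qed.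

Lemma zero_below_agree N x y : zero_below N x -> zero_below N y -> agree N x y.
Proof. by move=> hx hy j jN; rewrite hx ?hy. Qed.

Lemma agree_eq x y : (forall n, agree n x y) -> x = y.
Proof. by move=> h; apply: qp_ext => j; apply: (h (j + 1)); lia. Qed.

Lemma first_difference x y : x <> y ->
  exists n, agree n x y /\ digit x n <> digit y n.
Proof.
move=> xy; have [M [Mx My]] := zero_below2 x y; have Mxy := zero_below_agree Mx My.
have ex : exists k : nat, digit x (M + k%:Z) != digit y (M + k%:Z).
  apply: contrapT => nex; apply: xy; apply: qp_ext => j.
  have [/Mxy//|Mj] := ltP j M.
  apply/eqP/negPn/negP => dj; apply: nex; exists `|(j - M)%R|%N.
  by have -> : M + `|(j - M)%R|%N%:Z = j by lia.
have [k dk kmin] := ex_minnP ex; exists (M + k%:Z); split; last exact/eqP.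
move=> j jk; have [/Mxy//|Mj] := ltP j M.
apply/eqP/negPn/negP => dj.
have := kmin `|(j - M)%R|%N; have -> : M + `|(j - M)%R|%N%:Z = j by lia.
by move/(_ dj); lia.
Qed.

(** For [x] in [p^N Z_p] this is the residue of [p^{-N} x] modulo [p^k]; through it the arithmetic
    of [QP] is transferred to the rings [Z/p^k]. *)
Definition W N k x : nat := \sum_(i < k) digit x (N + i%:Z) * p ^ i.

Lemma W0 N x : W N 0 x = 0%N. Proof. by rewrite /W big_ord0. Qed.

Lemma WS N k x : W N k.+1 x = (W N k x + digit x (N + k%:Z) * p ^ k)%N.
Proof. by rewrite /W big_ord_recr. Qed.

Lemma W_split N j k x : W N (j + k) x = (W N j x + p ^ j * W (N + j%:Z) k x)%N.
Proof.
elim: k => [|k IH]; first by rewrite addn0 W0 muln0 addn0.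
by rewrite addnS !WS IH mulnDr addnA expnD PoszD addrA mulnCA mulnA.
Qed.

Lemma W_lt N k x : (W N k x < p ^ k)%N.
Proof.
elim: k => [|k IH]; first by rewrite W0.
by rewrite WS expnS; have := digit_lt x (N + k%:Z); nia.
Qed.

Lemma W_mod N j k x : (j <= k)%N -> (W N k x %% p ^ j = W N j x)%N.
Proof.
move=> jk; rewrite -(subnKC jk) W_split mulnC addnC modnMDl modn_small //.
exact: W_lt.
Qed.

Lemma W_modS N j k x : W N (j + k) x = W N j x %[mod p ^ j].
Proof. by rewrite W_mod ?leq_addr // modn_small // W_lt. Qed.

Lemma W_agree N k x y : agree (N + k%:Z) x y -> W N k x = W N k y.
Proof. by move=> h; apply: eq_bigr => i _; rewrite h //; have := ltn_ord i; lia. Qed.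

Lemma W_inj N k x y : zero_below N x -> zero_below N y -> W N k x = W N k y ->
  agree (N + k%:Z) x y.
Proof.
move=> Nx Ny; elim: k => [|k IH] h; first by rewrite addr0; exact: zero_below_agree.
have h' : W N k x = W N k y.
  by rewrite -(W_mod N x (leqnSn k)) h W_mod.
have -> : N + k.+1%:Z = (N + k%:Z) + 1 by lia.
apply: agreeS; first exact: IH.
move: h; rewrite !WS h' => /addnI/eqP; rewrite eqn_pmul2r ?expn_gt0 ?p_gt0 //.
by move/eqP.
Qed.

Lemma W_zero_below N k x : zero_below (N + k%:Z) x -> W N k x = 0%N.
Proof. by move=> h; apply: big1 => i _; rewrite h //; have := ltn_ord i; lia. Qed.

(** The digit at [N] vanishes, so raising the base by one divides the residue by [p]; [modS_down]
    and [modS_up] move congruences between the two bases accordingly. *)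
Lemma W_shift N k x : zero_below (N + 1) x -> W N k.+1 x = (p * W (N + 1) k x)%N.
Proof. by move=> h; rewrite -add1n W_split W_zero_below // expn1. Qed.

Lemma modS_down k a b : (a = b %[mod p ^ k] -> p * a = p * b %[mod p ^ k.+1])%N.
Proof. by move=> /eqP h; apply/eqP; rewrite expnS -!muln_modr (eqP h). Qed.

Lemma modS_up k a b : (p * a = p * b %[mod p ^ k.+1] -> a = b %[mod p ^ k])%N.
Proof.
by move=> /eqP; rewrite expnS -!muln_modr eqn_pmul2l // => /eqP.
Qed.

(** Invariant of column addition: the carry out of the first [k] columns has weight [p ^ k], so it
    is invisible modulo [p ^ k]. *)
Lemma add_carryE x y N k : (W N k (MkQP p_gt0 (add_raw_valid p_gt0 (digit x) (digit y) N))
   + p ^ k * add_carry p (digit x) (digit y) N k)%N = (W N k x + W N k y)%N.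
Proof.
elim: k => [|k IH]; first by rewrite !W0 /= muln0.
rewrite !WS /=.
have -> : add_raw p (digit x) (digit y) N (N + k%:Z) =
   ((digit x (N + k%:Z) + digit y (N + k%:Z) + add_carry p (digit x) (digit y) N k) %% p)%N.
  rewrite /add_raw ifF; last by apply/negbTE; lia.
  by have -> : `|(N + k%:Z - N)%R|%N = k by lia.
move: IH; set c := add_carry _ _ _ _ _; set s := (_ + _ + c)%N => IH.
have := divn_eq s p; rewrite {1}/s expnS; set q := (s %/ p)%N; set r := (s %% p)%N.
nia.
Qed.

Lemma W_add N k x y : zero_below N x -> zero_below N y ->
  (W N k (qp_add x y) = W N k x + W N k y %[mod p ^ k])%N.
Proof.
move=> Nx Ny; move: k.
pose P N := forall k, (W N k (qp_add x y) = W N k x + W N k y %[mod p ^ k])%N.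
pose V N := zero_below N x /\ zero_below N y.
pose N0 : int := Num.min (lb x) (lb y).
have Vle N1 N2 : N1 <= N2 -> V N2 -> V N1 by move=> h []; split; apply: zero_below_le h _.
have N0x : zero_below N0 x by apply: (zero_below_le _ (@lb_zero_below x)); rewrite /N0; lia.
have N0y : zero_below N0 y by apply: (zero_below_le _ (@lb_zero_below y)); rewrite /N0; lia.
have N0z : zero_below N0 (qp_add x y) by move=> j jN /=; rewrite /add_raw jN.
pose Q N := [/\ P N, zero_below N x, zero_below N y & zero_below N (qp_add x y)].
suff h : V N -> Q N by case: h.
apply: (@int_updown V Q N0) => //.
- split=> // k; rewrite -(add_carryE x y N0 k) addnC mulnC modnMDl //.
- move=> M [PM Mx My Mz]; have le : M - 1 <= M by lia.
  split; try by apply: zero_below_le le _.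
  case=> [|k]; first by rewrite expn0 !modn1.
  by rewrite !W_shift ?subrK // -mulnDr; apply: modS_down.
- move=> M [Mx My] [PM _ _ Mz].
  have Mz' : zero_below M (qp_add x y).
    move=> j jM; have [/Mz//|h] := ltP j (M - 1).
    have -> : j = M - 1 by lia.
    (* For [k = 1] the congruence at base [M - 1] reads off the digit of the sum at [M - 1]; both
       summands have digit 0 there. *)
    have := PM 1%N; rewrite ![W _ 1 x]W_zero_below ?[W _ 1 y]W_zero_below ?subrK // addn0 expn1.
    rewrite WS W0 expn0 muln1 add0n addr0 mod0n modn_small //.
    exact: (digit_lt (qp_add x y)).
  split=> // k; apply: modS_up; have := PM k.+1.
  by rewrite !W_shift ?subrK // mulnDr.
Qed.

Lemma zero_below_add N x y : zero_below N x -> zero_below N y -> zero_below N (qp_add x y).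
Proof.
move=> Nx Ny; have [N' N'z] := zero_below_exists (qp_add x y).
have [|lt] := leP N N'; first by move=> /zero_below_le; apply.
have -> : N = N' + `|N - N'|%N%:Z by lia.
set k := `|_|%N.
have ex : zero_below N' x by apply: zero_below_le Nx; lia.
have ey : zero_below N' y by apply: zero_below_le Ny; lia.
have h : zero_below (N' + k%:Z) (qp_zero p_gt0) by move=> j _.
apply: (@agree_zero_below _ (N' + k%:Z) (qp_zero p_gt0)) => //.
apply: W_inj => //.
have := W_add k ex ey; rewrite [W N' k x]W_zero_below ?[W N' k y]W_zero_below; last 2 first.
- by apply: zero_below_le Ny; rewrite /k; lia.
- by apply: zero_below_le Nx; rewrite /k; lia.
by rewrite [W N' k (qp_zero _)]W_zero_below // addn0 mod0n modn_small ?W_lt.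
Qed.

(** [Z_p] as inverse limit of the [Z/p^k]: the digit at index [k] is the quotient of [r k.+1] by
    [p ^ k]. *)
Lemma digit_of_residues (r : nat -> nat) :
  (forall k, r k < p ^ k)%N -> (forall k, r k.+1 = r k %[mod p ^ k])%N ->
  forall N, exists z, zero_below N z /\ forall k, W N k z = r k.
Proof.
move=> rlt rmod N.
pose d (j : int) := if j < N then 0%N else (r `|j - N|.+1 %/ p ^ `|j - N|)%N.
have dv : qp_valid p d.
  split=> [j|]; last by exists N => j jN; rewrite /d jN.
  by rewrite /d; case: ifP => // _; rewrite ltn_divLR ?expn_gt0 ?p_gt0// -expnS.
exists (MkQP p_gt0 dv); split; first by move=> j jN /=; rewrite /d jN.
elim=> [|k IH]; first by rewrite W0; have := rlt 0%N; rewrite expn0; lia.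
rewrite WS IH /= /d ifF; last by apply/negbTE; lia.
have -> : `|(N + k%:Z - N)%R|%N = k by lia.
have -> : r k = (r k.+1 %% p ^ k)%N by rewrite rmod modn_small.
by rewrite addnC -divn_eq.
Qed.

(** [qp_sub] is picked by [epsilon], so its meaning rests on this existence. The residues of the
    difference are compatible and assemble into an element. *)
Lemma qp_sub_exists x y : exists z, qp_add z y = x.
Proof.
have [N [Nx Ny]] := zero_below2 x y.
pose r k := ((W N k x + (p ^ k - W N k y)) %% p ^ k)%N.
have rE k : (r k + W N k y = W N k x %[mod p ^ k])%N.
  rewrite /r modnDml -addnA subnK; last exact/ltnW/W_lt.
  by rewrite modnDr.
have rlt k : (r k < p ^ k)%N by rewrite ltn_pmod ?expn_gt0 ?p_gt0.
have rmod k : r k.+1 = r k %[mod p ^ k].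
  have h1 : (r k.+1 + W N k y = r k + W N k y %[mod p ^ k])%N.
    rewrite rE -[W N k y](W_mod _ _ (leqnSn k)) modnDmr.
    rewrite -(@modn_dvdm (p ^ k.+1) (r k.+1 + _)) ?dvdn_exp2l // rE modn_dvdm ?dvdn_exp2l //.
    by rewrite -addn1 W_modS.
  by apply/eqP; move/eqP: h1; rewrite eqn_modDr.
have [z [Nz Wz]] := digit_of_residues rlt rmod N.
exists z; apply: agree_eq => n.
have [nN|Nn] := leP n N.
  by apply: agree_le nN _; apply: zero_below_agree => //; exact: zero_below_add.
have -> : n = N + `|n - N|%N%:Z by lia.
apply: W_inj => //; first exact: zero_below_add.
have := W_add `|n - N|%N Nz Ny; rewrite Wz rE !modn_small ?W_lt //.
Qed.

Lemma qp_subK x y : qp_add (qp_sub x y) y = x.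
Proof. exact: (epsilon_spec (inhabits _) _ (qp_sub_exists x y)). Qed.

Lemma zero_below_sub N x y : zero_below N x -> zero_below N y -> zero_below N (qp_sub x y).
Proof.
move=> Nx Ny; set z := qp_sub x y; have [N' N'z] := zero_below_exists z.
have [|lt] := leP N N'; first by move=> /zero_below_le; apply.
have -> : N = N' + `|N - N'|%N%:Z by lia.
set k := `|_|%N.
have ex : zero_below N' x by apply: zero_below_le Nx; lia.
have ey : zero_below N' y by apply: zero_below_le Ny; lia.
have h : zero_below (N' + k%:Z) (qp_zero p_gt0) by move=> j _.
apply: (@agree_zero_below _ (N' + k%:Z) (qp_zero p_gt0)) => //.
apply: W_inj => //.
have := W_add k N'z ey; rewrite qp_subK [W N' k x]W_zero_below ?[W N' k y]W_zero_below; last 2 first.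
- by apply: zero_below_le Ny; rewrite /k; lia.
- by apply: zero_below_le Nx; rewrite /k; lia.
by rewrite [W N' k (qp_zero _)]W_zero_below // addn0 mod0n modn_small ?W_lt.
Qed.

Lemma W_sub N k x y : zero_below N x -> zero_below N y ->
  (W N k (qp_sub x y) + W N k y = W N k x %[mod p ^ k])%N.
Proof. by move=> Nx Ny; rewrite -W_add ?qp_subK //; exact: zero_below_sub. Qed.

(** On residues, [W N k t] is added or cancelled modulo [p ^ k]. This is how differences in balls
    and translates are turned into digit comparisons. *)
Lemma agree_sub n x y t : agree n (qp_sub x t) y <-> agree n x (qp_add y t).
Proof.
have [N1 [N1x N1y]] := zero_below2 x y; have [N2 [N2t _]] := zero_below2 t x.
pose N : int := Num.min (Num.min N1 N2) n.
have Nx : zero_below N x by apply: zero_below_le N1x; rewrite /N; lia.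
have Ny : zero_below N y by apply: zero_below_le N1y; rewrite /N; lia.
have Nt : zero_below N t by apply: zero_below_le N2t; rewrite /N; lia.
have -> : n = N + `|n - N|%N%:Z by rewrite /N; lia.
set k := `|_|%N.
have sub := W_sub k Nx Nt; have add := W_add k Ny Nt.
split=> h; apply: W_inj => //; try exact: zero_below_sub; try exact: zero_below_add.
  rewrite (W_agree h) in sub.
  by move: sub; rewrite -add !modn_small ?W_lt // => <-.
move: sub; rewrite (W_agree h) add => /eqP; rewrite eqn_modDr => /eqP.
by rewrite !modn_small ?W_lt.
Qed.

Lemma agree_sub0 n x y : agree n x y <-> zero_below n (qp_sub x y).
Proof.
have add0 : agree n (qp_add (qp_zero p_gt0) y) y.
  have [N [Ny _]] := zero_below2 y y.
  have [nN|Nn] := leP n N.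
    by apply: agree_le nN _; apply: zero_below_agree => //; apply: zero_below_add.
  have -> : n = N + `|n - N|%N%:Z by lia.
  apply: W_inj => //; first by apply: zero_below_add.
  have := @W_add N `|n - N|%N (qp_zero p_gt0) y (fun _ _ => erefl) Ny.
  by rewrite [W _ _ (qp_zero _)]W_zero_below // add0n !modn_small ?W_lt.
split=> h.
  have : agree n (qp_sub x y) (qp_zero p_gt0).
    by apply/agree_sub; apply: agree_trans h _; exact: agree_sym.
  by [].
by apply: agree_trans add0; apply/agree_sub.
Qed.

Lemma agree_subl n x y t : agree n (qp_sub x t) (qp_sub y t) <-> agree n x y.
Proof. by rewrite agree_sub qp_subK. Qed.

Lemma digit_add_nocarry x y : (forall j, digit x j + digit y j < p)%N ->
  forall j, digit (qp_add x y) j = (digit x j + digit y j)%N.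
Proof.
move=> h j; rewrite /= /add_raw.
set N := Num.min _ _.
have c0 k : add_carry p (digit x) (digit y) N k = 0%N.
  by elim: k => //= k ->; rewrite addn0 divn_small.
case: ifP => [jN|_]; last by rewrite c0 addn0 modn_small.
by rewrite !lb_zero_below //; move: jN; rewrite /N; lia.
Qed.

Definition suppset (J : set int) : set QP := [set x | forall j, ~ J j -> digit x j = 0%N].

(** The monomials of a sum have distinct exponents because [e] is injective, so no carry occurs and
    digits can be read off. Conversely an element supported below [b] has only finitely many nonzero
    digits, hence is such a finite sum. *)
Lemma digit_sumsetE (I : set int) (e : int -> int) (b : int) :
  involutive e -> (forall j, I (e j) -> j < b) ->
  (digit_sumset I e : set QP) = suppset [set j | I (e j)].
Proof.
move=> eK bnd.
pose f (a : int -> 'I_p) i (acc : QP) := qp_add (@qp_mono _ p_gt0 (a i) (e i)) acc.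
have foldrE a s : uniq s -> forall j,
    digit (foldr (f a) (qp_zero p_gt0) s) j = if e j \in s then a (e j) : nat else 0%N.
  elim: s => [|i s IH] //= /andP[si us] j.
  have nc l : (digit (@qp_mono _ p_gt0 (a i) (e i)) l +
               digit (foldr (f a) (qp_zero p_gt0) s) l < p)%N.
    rewrite IH //=; case: eqP => [->|_]; last by rewrite add0n; case: ifP.
    by rewrite eK (negbTE si) addn0.
  move: (digit_add_nocarry nc j); rewrite /= => ->; rewrite IH // inE.
  have -> : (j == e i) = (e j == i) by apply/eqP/eqP => [->|<-]; rewrite eK.
  by case: eqP => [->|_] //=; rewrite (negbTE si) addn0.
apply/seteqP; split=> [x [s [a [us [sI ->]]]] j nJ /=|x xJ].
  by rewrite foldrE //; case: ifP => // /sI; move/nJ.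
have [N Nx] := zero_below_exists x.
(* The indices of the allowed positions from [N] up to [b], outside of which the digits of [x]
   vanish. *)
pose s := [seq e (N + k%:Z) | k <- iota 0 `|b - N|%N & `[< I (e (N + k%:Z)) >]].
exists s, (fun i => Ordinal (digit_lt x (e i))); split; [|split].
- rewrite map_inj_uniq ?filter_uniq ?iota_uniq // => k l /(can_inj eK).
  by move/addrI => -[].
- by move=> i /mapP[k]; rewrite mem_filter => /andP[/asboolP ? _] ->.
apply: qp_ext => j.
have := foldrE (fun i => Ordinal (digit_lt x (e i))) s; rewrite /f => ->.
  rewrite /= eK; case: ifPn => // /negP js.
  have [Ij|/xJ//] := pselect (I (e j)).
  have [/Nx//|Nj] := ltP j N.
  exfalso; apply: js; apply/mapP; exists `|j - N|%N.
    rewrite mem_filter mem_iota /=.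
    have -> : N + `|j - N|%N%:Z = j by lia.
    by move: (bnd _ Ij) => ?; apply/andP; split; [exact/asboolP|lia].
  by have -> : N + `|j - N|%N%:Z = j by lia.
rewrite map_inj_uniq ?filter_uniq ?iota_uniq // => k l /(can_inj eK).
by move/addrI => -[].
Qed.

End Arithmetic.

(** * Metric, products and fractional parts *)

Section Metric.
Variables (p : nat) (p_gt0 : (0 < p)%N).
Hypothesis p_gt1 : (1 < p)%N.
Local Notation QP := (QP_ p_gt0).
Local Notation "0q" := (qp_zero p_gt0).
Implicit Types (x y z : QP) (N n : int) (k : nat).

Lemma vpP z : z <> 0q -> digit z (vp z) <> 0%N /\ zero_below (vp z) z.
Proof.
move=> z0; apply: (epsilon_spec (inhabits (0 : int))
  (fun v => digit z v <> 0%N /\ forall n, n < v -> digit z n = 0%N)).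
by have [n [nz dz]] := first_difference z0; exists n.
Qed.

Lemma zero_below_vp z n : z <> 0q -> zero_below n z <-> n <= vp z.
Proof.
move=> z0; have [dz vz] := vpP z0; split=> [nz|le]; last exact: zero_below_le vz.
by rewrite leNgt; apply/negP => /nz.
Qed.

Lemma absp_le z n : (absp z <= (p%:R : rat) ^ (- n)) <-> zero_below n z.
Proof.
rewrite /absp; case: eqP => [->|z0].
  by split=> // _; apply: exprz_ge0.
rewrite zero_below_vp // ler_eXz2l ?ltr1n //; split; lia.
Qed.

Lemma absp_eq z z' : (forall n, zero_below n z <-> zero_below n z') -> absp z = absp z'.
Proof.
move=> h; rewrite /absp; have all0 x : (forall n, zero_below n x) -> x = 0q.
  by move=> nx; apply: qp_ext => j; apply: (nx (j + 1)); lia.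
case: eqP => z0; case: eqP => z0' //.
- by case: z0'; apply: all0 => n; apply/h; rewrite z0.
- by case: z0; apply: all0 => n; apply/h; rewrite z0'.
suff -> : vp z = vp z' by [].
apply/eqP; rewrite eq_le; apply/andP; split.
  by apply/zero_below_vp => //; apply/h/zero_below_vp.
by apply/zero_below_vp => //; apply/h/zero_below_vp.
Qed.

Lemma vp_subP x y n :
  (x <> y /\ vp (qp_sub x y) = n) <-> (agree n x y /\ digit x n <> digit y n).
Proof.
have sub0 : x <> y -> qp_sub x y <> 0q.
  by move=> xy s0; apply: xy; apply: agree_eq => m; apply/agree_sub0; rewrite s0.
split=> [[xy <-]|[nxy dxy]].
  have [dz vz] := vpP (sub0 xy); have vxy := (agree_sub0 _ _ _).2 vz.
  split=> // dxy; apply: dz; apply: ((agree_sub0 (vp (qp_sub x y) + 1) x y).1); last by lia.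
  exact: agreeS.
have xy : x <> y by move=> xy; rewrite xy in dxy.
split=> //; apply/eqP; rewrite eq_le; apply/andP; split.
  rewrite leNgt; apply/negP => lt; apply: dxy.
  by have [_ vz] := vpP (sub0 xy); have := (agree_sub0 _ _ _).2 vz; exact.
by apply/zero_below_vp; [exact: sub0|apply/agree_sub0].
Qed.

Lemma qp_ballE (a : QP) n : qp_ball a n = [set x | agree n x a].
Proof. by apply/seteqP; split=> x /=; rewrite agree_sub0 -absp_le. Qed.

Lemma isometryP (f : QP -> QP) :
  (forall x y, absp (qp_sub (f x) (f y)) = absp (qp_sub x y)) <->
  (forall n x y, agree n (f x) (f y) <-> agree n x y).
Proof.
split=> [h n x y|h x y]; first by rewrite !agree_sub0 -!absp_le h.
by apply: absp_eq => n; rewrite -!agree_sub0.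
Qed.

(** The triangular double sum is reordered by the first index: with index [i] fixed, the second runs
    below [k - i] and sums to a truncated residue of [y]. *)
Lemma conv_sum x y Nx Ny k :
  (\sum_(m < k) Defs.conv (digit x) (digit y) Nx Ny m * p ^ m =
   \sum_(i < k) digit x (Nx + i%:Z) * p ^ i * W Ny (k - i) y)%N.
Proof.
elim: k => [|k IH]; first by rewrite !big_ord0.
rewrite big_ord_recr /= {}IH [RHS]big_ord_recr /= subSn // subnn WS W0 expn0.
rewrite muln1 add0n addr0 /Defs.conv big_ord_recr /= mulnDl addnA subnn addr0.
congr (_ + _)%N; last by rewrite mulnAC.
rewrite big_distrl /= -big_split; apply: eq_bigr => i _ /=.
have ik : (i <= k)%N by apply: ltnW.
rewrite subSn // WS mulnDr; congr (_ + _)%N.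
have -> : (p ^ k = p ^ i * p ^ (k - i))%N by rewrite -expnD subnKC.
exact: mulnACA.
Qed.

Lemma W_mulmod x y Nx Ny k :
  (\sum_(m < k) Defs.conv (digit x) (digit y) Nx Ny m * p ^ m =
   W Nx k x * W Ny k y %[mod p ^ k])%N.
Proof.
rewrite conv_sum /W big_distrl /=.
elim/big_rec2: _ => // i a b _ h.
rewrite -modnDm -[RHS]modnDm h; congr ((_ + _) %% _)%N; rewrite -/(W Ny k y).
have ik : (i <= k)%N by apply: ltnW.
have -> : (p ^ k = p ^ i * p ^ (k - i))%N by rewrite -expnD subnKC.
rewrite -/(W Ny (k - i) y) [(digit _ _ * p ^ i)%N]mulnC -!mulnA -!muln_modr.
by congr (_ * _)%N; rewrite -[RHS]modnMmr W_mod ?leq_subr.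
Qed.

Lemma mul_carryE x y Nx Ny k :
  (W (Nx + Ny) k (MkQP p_gt0 (mul_raw_valid p_gt0 (digit x) (digit y) Nx Ny))
   + p ^ k * mul_carry p (digit x) (digit y) Nx Ny k =
   \sum_(m < k) Defs.conv (digit x) (digit y) Nx Ny m * p ^ m)%N.
Proof.
elim: k => [|k IH]; first by rewrite !W0 big_ord0 muln0.
rewrite !WS big_ord_recr /=.
have -> : mul_raw p (digit x) (digit y) Nx Ny (Nx + Ny + k%:Z) =
   ((Defs.conv (digit x) (digit y) Nx Ny k + mul_carry p (digit x) (digit y) Nx Ny k) %% p)%N.
  rewrite /mul_raw ifF; last by apply/negbTE; lia.
  by have -> : `|(Nx + Ny + k%:Z - (Nx + Ny))%R|%N = k by lia.
move: IH; set c := mul_carry _ _ _ _ _ _; set t := Defs.conv _ _ _ _ _; set s := (t + c)%N => IH.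
have := divn_eq s p; rewrite {1}/s expnS; set q := (s %/ p)%N; set r := (s %% p)%N.
move=> e; rewrite -IH.
have : ((t + c) * p ^ k = (q * p + r) * p ^ k)%N by rewrite e.
by clear; set w := W _ _ _; move: w (p ^ k)%N => w P; nia.
Qed.

Lemma W_mul x y Nx Ny k : zero_below Nx x -> zero_below Ny y ->
  zero_below (Nx + Ny) (qp_mul x y) /\
  (W (Nx + Ny) k (qp_mul x y) = W Nx k x * W Ny k y %[mod p ^ k])%N.
Proof.
move=> Nxx Nyy; move: k; pose z := qp_mul x y.
pose P a b := [/\ zero_below a x, zero_below b y, zero_below (a + b) z &
  forall k, (W (a + b) k z = W a k x * W b k y %[mod p ^ k])%N].
suff : P Nx Ny by case=> _ _ h h' k; split.
have P0 : P (lb x) (lb y).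
  split; [exact: lb_zero_below|exact: lb_zero_below|by move=> j jN /=; rewrite /mul_raw jN|].
  by move=> k; rewrite -W_mulmod -mul_carryE addnC mulnC modnMDl.
(* The moves [down] and [up] below treat the first factor; [Psym] exchanges the factors to reuse
   them for the second. *)
have Psym (x1 y1 : QP) a b : (forall k, (W (a + b) k z = W a k x1 * W b k y1 %[mod p ^ k])%N) ->
  forall k, (W (b + a) k z = W b k y1 * W a k x1 %[mod p ^ k])%N.
  by move=> h k; rewrite addrC mulnC.
have down (x1 y1 : QP) a b : zero_below a x1 -> zero_below (a + b) z ->
    (forall k, (W (a + b) k z = W a k x1 * W b k y1 %[mod p ^ k])%N) ->
    forall k, (W (a - 1 + b) k z = W (a - 1) k x1 * W b k y1 %[mod p ^ k])%N.
  move=> ax abz h [|k]; first by rewrite expn0 !modn1.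
  have E : a - 1 + b + 1 = a + b by lia.
  rewrite [W (a - 1 + b) _ z]W_shift ?[W (a - 1) _ x1]W_shift ?subrK ?E // -mulnA.
  apply: modS_down.
  by rewrite h -modnMmr -[RHS]modnMmr -addn1 W_modS.
have up (x1 y1 : QP) a b : zero_below a x1 -> zero_below (a - 1 + b) z ->
    (forall k, (W (a - 1 + b) k z = W (a - 1) k x1 * W b k y1 %[mod p ^ k])%N) ->
    zero_below (a + b) z /\
    forall k, (W (a + b) k z = W a k x1 * W b k y1 %[mod p ^ k])%N.
  move=> ax abz h; have E : a - 1 + b + 1 = a + b by lia.
  have abz' : zero_below (a + b) z.
    move=> j jM; have [/abz//|h'] := ltP j (a - 1 + b).
    have -> : j = a - 1 + b by lia.
    have := h 1%N; rewrite [W _ 1 x1]W_zero_below ?subrK // mul0n expn1.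
    by rewrite WS W0 expn0 muln1 add0n addr0 mod0n modn_small // digit_lt.
  split=> // k; apply: (modS_up p_gt0); move: (h k.+1).
  rewrite (@W_shift _ _ (a - 1 + b)) ?E // (@W_shift _ _ (a - 1)) ?subrK // -mulnA => ->.
  apply: modS_down.
  by rewrite -modnMmr -[RHS]modnMmr -addn1 W_modS.
(* First the base of [x] goes from [lb x] to [Nx], then that of [y] from [lb y] to [Ny]. *)
have Px : P Nx (lb y).
  apply: (@int_updown (fun a => zero_below a x) (fun a => P a (lb y)) (lb x)) => //.
  - move=> a [ax yy az h]; split=> //; first by apply: zero_below_le ax; lia.
    + by apply: zero_below_le az; lia.
    + exact: down.
  - by move=> a ax [_ yy az /up[]// ? ?]; split.
  - by move=> a b ab; exact: zero_below_le.
apply: (@int_updown (fun b => zero_below b y) (fun b => P Nx b) (lb y)) => //.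
- move=> b [xx bx az h]; split=> //; first by apply: zero_below_le bx; lia.
  + by apply: zero_below_le az; lia.
  + apply: (Psym y x); apply: (down y x b Nx bx); first by rewrite addrC.
    exact: (Psym x y).
- move=> b bx [xx _ az h].
  have az' : zero_below (b - 1 + Nx) z by rewrite addrC.
  have [abz h'] := up y x b Nx bx az' (Psym _ _ _ _ h).
  split=> //; first by rewrite addrC.
  exact: (Psym y x).
- by move=> a b ab; exact: zero_below_le.
Qed.

(** [frac] sums from the chosen base [lb z], which may lie on either side of [- k]; [indep] shows
    that padding by zero digits below leaves the quotient unchanged. *)
Lemma frac_W z k : zero_below (- k%:Z) z -> Defs.frac z = (W (- k%:Z) k z)%:R / p%:R ^+ k.
Proof.
have p0 : (p%:R : rat) != 0 by rewrite pnatr_eq0; lia.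
have indep (l m : nat) : zero_below (- l%:Z) z -> (l <= m)%N ->
    (W (- l%:Z) l z)%:R / p%:R ^+ l = (W (- m%:Z) m z)%:R / p%:R ^+ m :> rat.
  move=> lz lm; rewrite -(subnK lm) W_split.
  have E : - (m - l + l)%N%:Z + (m - l)%N%:Z = - l%:Z by lia.
  rewrite E [W _ (m - l) z]W_zero_below ?E // add0n natrM natrX exprD.
  by rewrite invfM mulrACA divff ?mul1r // expf_neq0.
move=> kz; rewrite /Defs.frac; set N := lb z.
have Nz : zero_below N z := @lb_zero_below _ _ z.
have [N0|N0] := leP 0 N.
  by rewrite absz0 big_ord0 W_zero_below ?mul0r //; apply: zero_below_le Nz; lia.
set l := `|N|%N.
have E : N = - l%:Z by rewrite /l; lia.
have -> : \sum_(k0 < l) ((digit z (N + k0%:Z))%:R * (p%:R : rat) ^ (N + k0%:Z)) =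
   (W (- l%:Z) l z)%:R / p%:R ^+ l.
  rewrite /W natr_sum mulr_suml; apply: eq_bigr => i _.
  rewrite -E natrM natrX -mulrA; congr (_ * _).
  by rewrite E expfzDr // -exprnN mulrC.
have lz : zero_below (- l%:Z) z by rewrite -E.
by have [lk|/ltnW kl] := leqP l k; [exact: indep|rewrite -(indep k)].
Qed.

(** The product lies in [p^{-L} Z_p] and its residue is the product of the residues modulo [p ^ L].
    The integer [c] undoes that reduction and does not affect characters. *)
Lemma frac_mul l x n M L : zero_below (- n) l -> zero_below M x -> n = M + L%:Z ->
  exists c : int, Defs.frac (qp_mul l x) =
    (W (- n) L l)%:R * (W M L x)%:R / p%:R ^+ L + c%:~R.
Proof.
move=> nl Mx nE; have p0 : (p%:R : rat) != 0 by rewrite pnatr_eq0; lia.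
have [lz Wz] := W_mul L nl Mx; have E : - n + M = - L%:Z by lia.
move: lz Wz; rewrite E => lz Wz.
rewrite (frac_W lz); set w := W _ _ (qp_mul _ _) in Wz *.
set a := (W (- n) L l * W M L x)%N in Wz.
exists (- (a %/ p ^ L)%N%:Z); rewrite -natrM -/a {1}(divn_eq a (p ^ L)) -Wz.
rewrite modn_small ?W_lt // natrD natrM natrX mulrDl mulfK ?expf_neq0 //.
by rewrite mulrNz addrAC -[X in X + _ + _](pmulrn) subrr add0r.
Qed.

End Metric.

(** * Trees *)

Section Trees.
Variables (p : nat) (p_gt0 : (0 < p)%N).
Local Notation QP := (QP_ p_gt0).
Local Notation "0q" := (qp_zero p_gt0).
Implicit Types (x y z : QP) (N n : int) (k : nat) (J : set int) (S : set QP).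

(** Contrapositive of first differences lying in [J]: off [J], a digit is a function of the earlier
    digits. *)
Definition ord_in J S := forall s s' n, S s -> S s' ->
  agree n s s' -> ~ J n -> digit s n = digit s' n.

Definition saturated J S := forall s n (d : nat), S s -> J n -> (d < p)%N ->
  exists s', [/\ S s', agree n s s' & digit s' n = d].

Definition tree J S := [/\ S !=set0, ord_in J S & saturated J S].

Lemma ord_in_agree J S s s' n : ord_in J S -> S s -> S s' ->
  (forall j, j < n -> J j -> digit s j = digit s' j) -> agree n s s'.
Proof.
move=> oS Ss Ss' h; have [N [Ns Ns']] := zero_below2 s s'.
have k_ind k : N + k%:Z <= n -> agree (N + k%:Z) s s'.
  elim: k => [_|k IH kn]; first by rewrite addr0; exact: zero_below_agree.
  have -> : N + k.+1%:Z = N + k%:Z + 1 by lia.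
  have a : agree (N + k%:Z) s s' by apply: IH; lia.
  apply: agreeS => //; have [Jn|nJ] := pselect (J (N + k%:Z)); last exact: oS a nJ.
  by apply: h => //; lia.
have [nN|Nn] := leP n N; first by apply: agree_le nN _; exact: zero_below_agree.
have -> : n = N + `|(n - N)%R|%N%:Z by lia.
by apply: k_ind; lia.
Qed.

(** Climb from [N], branching at each position of [J]. A branch keeps all earlier digits, so those
    already prescribed survive. *)
Lemma tree_realize J S s0 N (d : int -> nat) k : tree J S -> S s0 -> zero_below N s0 ->
  (forall j, (d j < p)%N) ->
  exists s, [/\ S s, zero_below N s &
    forall j, N <= j -> j < N + k%:Z -> J j -> digit s j = d j].
Proof.
move=> [_ oS sS] Ss0 Ns0 dp; elim: k => [|k [s [Ss Ns h]]].
  by exists s0; split=> // j h1 h2; lia.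
have [Jk|nJk] := pselect (J (N + k%:Z)).
  have [s' [Ss' ss' ds']] := sS s _ _ Ss Jk (dp (N + k%:Z)).
  exists s'; split=> //; first by apply: agree_zero_below ss' Ns; lia.
  move=> j Nj jk Jj; have [lt|ge] := ltP j (N + k%:Z); first by rewrite -ss' ?h.
  by have -> : j = N + k%:Z by lia.
exists s; split=> // j Nj jk Jj; have [lt|ge] := ltP j (N + k%:Z); first exact: h.
have jE : j = N + k%:Z by lia.
by rewrite jE in Jj.
Qed.

Lemma set_digit_valid x n (d : nat) : (d < p)%N ->
  qp_valid p (fun j => if j == n then d else digit x j).
Proof.
move=> dp; split=> [j|]; first by case: ifP => // _; exact: digit_lt.
have [N Nx] := zero_below_exists x; exists (Num.min N n) => j jN.
by rewrite ifF ?Nx //; [lia|apply/eqP; lia].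
Qed.

(** For saturation, vary the digit [n] of [x] over all [p] values. The isometry makes the digits of
    the images at [n] pairwise distinct, so by finiteness every digit is attained. *)
Lemma isometric_image_tree J (f : QP -> QP) : (1 < p)%N -> isometric_bijection f ->
  tree J (f @` suppset J).
Proof.
move=> p_gt1 [fbij /(isometryP p_gt1) fiso]; split.
- by exists (f 0q); exists 0q.
- move=> _ _ n [x Jx <-] [y Jy <-] /fiso xy nJ.
  have : agree (n + 1) (f x) (f y).
    by apply/fiso; apply: agreeS => //; rewrite Jx ?Jy.
  by apply; lia.
move=> _ n d [x Jx <-] Jn dp.
pose y (e : 'I_p) : QP := MkQP p_gt0 (set_digit_valid x n (ltn_ord e)).
have xy e : agree n (y e) x by move=> j jn /=; rewrite lt_eqF.
have Jy e : suppset J (y e).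
  by move=> j nJj /=; case: eqP => [jn|_]; [rewrite jn in nJj|exact: Jx].
pose h (e : 'I_p) : 'I_p := Ordinal (digit_lt (f (y e)) n).
have hinj : injective h.
  move=> e e' /(congr1 val) /= dee'; apply: val_inj => /=.
  have : agree (n + 1) (y e) (y e').
    apply/fiso; apply: agreeS => //; apply/fiso.
    by apply: agree_trans (xy e) _; exact: agree_sym.
  by move=> /(_ n); rewrite /= eqxx; apply; lia.
have [g _ hg] := injF_bij hinj.
exists (f (y (g (Ordinal dp)))); split.
- by exists (y (g (Ordinal dp))).
- by apply/fiso; exact: agree_sym.
- by have := congr1 val (hg (Ordinal dp)).
Qed.

Lemma proj_valid J x : qp_valid p (fun j => if `[< J j >] then digit x j else 0%N).
Proof.
split=> [j|]; first by case: ifP => // _; exact: digit_lt.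
by have [N Nx] := zero_below_exists x; exists N => j /Nx ->; rewrite if_same.
Qed.

Definition proj J x : QP := MkQP p_gt0 (proj_valid J x).

(** Below [N] both elements vanish and above [b] nothing is prescribed, so finitely many branchings
    suffice. *)
Lemma tree_section J S (b : int) : (forall j, J j -> j < b) -> tree J S ->
  forall x, exists s, S s /\ forall j, J j -> digit s j = digit x j.
Proof.
move=> Jb tS x; have [[s0 Ss0] _ _] := tS.
have [N [Ns Nx]] := zero_below2 s0 x.
have [s [Ss Ns' h]] := tree_realize `|(b - N)%R|%N tS Ss0 Ns (digit_lt x).
exists s; split=> // j Jj; have [jN|Nj] := ltP j N; first by rewrite Ns' ?Nx.
by apply: h => //; move: (Jb _ Jj) => ?; lia.
Qed.

Lemma twist_valid (c : bool -> nat -> nat -> nat) x y J :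
  (forall b i j, i < p -> j < p -> c b i j < p)%N -> (forall b, c b 0%N 0%N = 0%N) ->
  qp_valid p (fun j => c `[< J j >] (digit x j) (digit y j)).
Proof.
move=> cp c0; split=> [j|]; first by apply: cp; exact: digit_lt.
by have [N [Nx Ny]] := zero_below2 x y; exists N => j jN; rewrite Nx ?Ny.
Qed.

(* The isometry keeps the [J]-digits of [x] and shifts each other digit, modulo
   [p], by the corresponding digit of the element of [S] having the same
   [J]-digits as [x]. *)
Lemma tree_isometric_image J S (b : int) : (1 < p)%N -> (forall j, J j -> j < b) -> tree J S ->
  exists f, isometric_bijection f /\ S = f @` suppset J.
Proof.
move=> p_gt1 Jb tS; have [g gP] := choice (tree_section Jb tS).
have [_ oS _] := tS.
have gag n x y : agree n x y -> agree n (g x) (g y).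
  move=> xy; apply: (ord_in_agree oS); [exact: (gP x).1|exact: (gP y).1|].
  by move=> j jn Jj; rewrite (gP x).2 ?(gP y).2 ?xy.
have gagS n x y : agree n x y -> ~ J n -> digit (g x) n = digit (g y) n.
  by move=> /gag h nJ; apply: oS h nJ; [exact: (gP x).1|exact: (gP y).1].
have gproj x y : (forall j, J j -> digit x j = digit y j) -> g x = g y.
  move=> h; apply: agree_eq => n; apply: (ord_in_agree oS); [exact: (gP x).1|exact: (gP y).1|].
  by move=> j jn Jj; rewrite (gP x).2 ?(gP y).2 ?h.
pose cf (B : bool) (i j : nat) := if B then i else ((i + j) %% p)%N.
pose cg (B : bool) (i j : nat) := if B then i else ((i + (p - j)) %% p)%N.
have cfv x y : qp_valid p (fun j => cf `[< J j >] (digit x j) (digit y j)).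
  apply: (@twist_valid cf); last by case; rewrite /cf ?mod0n.
  by case=> i j ip jp; rewrite /cf ?ltn_pmod.
have cgv x y : qp_valid p (fun j => cg `[< J j >] (digit x j) (digit y j)).
  apply: (@twist_valid cg); last by case; rewrite /cg ?subn0 ?add0n ?modnn.
  by case=> i j ip jp; rewrite /cg ?ltn_pmod.
pose f x : QP := MkQP p_gt0 (cfv x (g x)).
pose f' x : QP := MkQP p_gt0 (cgv x (g x)).
have fJ x j : J j -> digit (f x) j = digit x j.
  by move=> Jj; rewrite /= /cf asboolT.
have f'J x j : J j -> digit (f' x) j = digit x j.
  by move=> Jj; rewrite /= /cg asboolT.
have fnJ x j : ~ J j -> digit (f x) j = ((digit x j + digit (g x) j) %% p)%N.
  by move=> Jj; rewrite /= /cf asboolF.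
have f'nJ x j : ~ J j -> digit (f' x) j = ((digit x j + (p - digit (g x) j)) %% p)%N.
  by move=> Jj; rewrite /= /cg asboolF.
(* [g] depends only on [J]-digits, which [f] keeps; thus [g (f x) = g x], and subtracting the same
   digits undoes [f]. *)
have fK : cancel f f'.
  move=> x; apply: qp_ext => j; have [Jj|nJ] := pselect (J j); first by rewrite f'J ?fJ.
  rewrite f'nJ // fnJ // (gproj (f x) x); last exact: fJ.
  rewrite modnDml -addnA subnKC; last exact/ltnW/digit_lt.
  by rewrite modnDr modn_small ?digit_lt.
have f'K : cancel f' f.
  move=> x; apply: qp_ext => j; have [Jj|nJ] := pselect (J j); first by rewrite fJ ?f'J.
  rewrite fnJ // f'nJ // (gproj (f' x) x); last exact: f'J.
  rewrite modnDml -addnA subnK; last exact/ltnW/digit_lt.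
  by rewrite modnDr modn_small ?digit_lt.
have fag n x y : agree n x y -> agree n (f x) (f y).
  move=> xy j jn; have [Jj|nJ] := pselect (J j); first by rewrite !fJ ?xy.
  by rewrite !fnJ // xy // (gag n x y).
have f'ag n x y : agree n x y -> agree n (f' x) (f' y).
  move=> xy j jn; have [Jj|nJ] := pselect (J j); first by rewrite !f'J ?xy.
  by rewrite !f'nJ // xy // (gag n x y).
have fg x : suppset J x -> f x = g x.
  move=> Jx; apply: qp_ext => j; have [Jj|nJ] := pselect (J j).
    by rewrite fJ // (gP x).2.
  by rewrite fnJ // Jx // add0n modn_small ?digit_lt.
exists f; split; first split.
- by exists f'.
- apply/(isometryP p_gt1) => n x y; split; last exact: fag.
  by move=> /f'ag; rewrite !fK.
apply/seteqP; split=> [s Ss|_ [x Jx <-]]; last by rewrite fg //; exact: (gP x).1.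
have Js : suppset J (proj J s) by move=> j nJ /=; rewrite asboolF.
exists (proj J s) => //; rewrite fg //.
apply: agree_eq => n; apply: (ord_in_agree oS) => //; first exact: (gP _).1.
by move=> j jn Jj; rewrite (gP _).2 //= asboolT.
Qed.

(** * Finite codes: the [J]-digits in a window *)

Definition window N (L : nat) J := {i : 'I_L | `[< J (N + i%:Z) >]}.

(** As a finite type this indexes the sums and counts below. For a tree, [code_inj] and [code_surj]
    say that codes are the classes of elements vanishing below [N], up to agreement below
    [N + L]. *)
Definition codes N (L : nat) J := {ffun window N L J -> 'I_p}.

Definition dcode N L J x : codes N L J :=
  [ffun i : window N L J => Ordinal (digit_lt x (N + (val i : nat)%:Z))].

Lemma codeP N L J x y : dcode N L J x = dcode N L J y <->
  forall j, N <= j -> j < N + L%:Z -> J j -> digit x j = digit y j.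
Proof.
split=> [/ffunP e j Nj jL Jj|h].
  have iL : (`|(j - N)%R| < L)%N by lia.
  have E : N + (Ordinal iL : nat)%:Z = j by rewrite /=; lia.
  have Ji : `[< J (N + (Ordinal iL : nat)%:Z) >] by rewrite E; exact/asboolP.
  have := e (exist _ (Ordinal iL) Ji); rewrite !ffunE => -[].
  by rewrite /= -/(nat_of_ord (Ordinal iL)) E.
apply/ffunP => -[i /= Ji]; rewrite !ffunE; apply: val_inj => /=.
by apply: h; [lia|have := ltn_ord i; lia|exact/asboolP].
Qed.

Lemma code_inj N L J S s s' : ord_in J S -> S s -> S s' -> zero_below N s -> zero_below N s' ->
  dcode N L J s = dcode N L J s' -> agree (N + L%:Z) s s'.
Proof.
move=> oS Ss Ss' Ns Ns' /codeP h; apply: (ord_in_agree oS) => // j jL Jj.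
by have [jN|Nj] := ltP j N; [rewrite Ns ?Ns'|exact: h].
Qed.

Lemma code_digit N L J (g : codes N L J) : exists d : int -> nat,
  (forall j, d j < p)%N /\ forall i : window N L J, d (N + (val i : nat)%:Z) = g i.
Proof.
pose d j := if pselect (exists i : window N L J, N + (val i : nat)%:Z = j) is left e
  then g (projT1 (cid e)) : nat else 0%N.
exists d; split=> [j|i]; first by rewrite /d; case: pselect.
rewrite /d; case: pselect => [e|[]]; last by exists i.
case: (cid e) => i' /= ii'; congr (nat_of_ord (g _)); apply: val_inj; apply: val_inj => /=.
by lia.
Qed.

Lemma code_surj N L J S s0 (g : codes N L J) : tree J S -> S s0 -> zero_below N s0 ->
  exists s, [/\ S s, zero_below N s & dcode N L J s = g].
Proof.
move=> tS Ss0 Ns0; have [d [dp dg]] := code_digit g.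
have [s [Ss Ns h]] := tree_realize L tS Ss0 Ns0 dp.
exists s; split=> //; apply/ffunP => i; rewrite ffunE; apply: val_inj => /=.
rewrite -dg /=; apply: h; [by rewrite lerDl|by rewrite ltrD2l ltz_nat|].
exact/asboolP/(valP i).
Qed.

(** To branch at [n], change that digit in the code of [s] over a window reaching [b], and realize
    the new code; [ord_in] makes the two elements agree below [n]. *)
Lemma tree_of_codes J S (b N0 : int) : (forall j, J j -> j < b) -> ord_in J S ->
  (forall N, N <= N0 -> forall g : codes N `|(b - N)%R|%N J,
    exists s, [/\ S s, zero_below N s & dcode N `|(b - N)%R|%N J s = g]) ->
  tree J S.
Proof.
move=> Jb oS h; split=> //.
  have [|s [Ss _ _]] := h N0 _ [ffun=> Ordinal p_gt0]; first by [].
  by exists s.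
move=> s n d Ss Jn dp; have [N Ns] := zero_below_exists s.
pose N1 : int := Num.min (Num.min N N0) n.
have N1s : zero_below N1 s by apply: zero_below_le Ns; rewrite /N1; lia.
have [|s' [Ss' Ns' cs']] :=
  h N1 _ (dcode N1 _ J (MkQP p_gt0 (set_digit_valid s n dp))); first by rewrite /N1; lia.
have nb := Jb _ Jn.
exists s'; split=> //.
  apply: (ord_in_agree oS) => // j jn Jj.
  have [jN|Nj] := ltP j N1; first by rewrite N1s ?Ns'.
  by move/codeP: cs' => -> //=; [rewrite lt_eqF|lia].
by move/codeP: cs' => -> //=; [rewrite eqxx|rewrite /N1; lia|rewrite /N1; lia].
Qed.

(** [t] raises the digit at [r] by one modulo [p]. Lower digits are unaffected, and the carry out of
    position [r] vanishes at this modulus. This symmetry makes the exponential sums vanish. *)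
Lemma W_code_shift N L J S (a : codes N L J -> QP) (r : window N L J) :
  ord_in J S -> (forall g, [/\ S (a g), zero_below N (a g) & dcode N L J (a g) = g]) ->
  exists2 t : codes N L J -> codes N L J, injective t &
    forall g, agree (N + (val r : nat)%:Z) (a g) (a (t g)) /\
      (W N L (a (t g)) = W N L (a g) + p ^ (val r : nat) %[mod p ^ (val r).+1])%N.
Proof.
move=> oS aP; set i := val r.
pose up (e : 'I_p) : 'I_p := Ordinal (ltn_pmod (e + 1) p_gt0).
have up_inj : injective up.
  move=> e e' /(congr1 val) /= /eqP; rewrite eqn_modDr => /eqP.
  by rewrite !modn_small // => /val_inj.
exists (fun g => [ffun j => if j == r then up (g j) else g j]).
  move=> g g' /ffunP gg'; apply/ffunP => j; have := gg' j; rewrite !ffunE.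
  by case: eqP => // _; exact: up_inj.
move=> g; set g' := [ffun j => _].
have iL : (i.+1 <= L)%N by exact: ltn_ord.
have [Sg Ng cg] := aP g; have [Sg' Ng' cg'] := aP g'.
have ag : agree (N + i%:Z) (a g) (a g').
  apply: (ord_in_agree oS) => // j ji Jj.
  have [jN|Nj] := ltP j N; first by rewrite Ng ?Ng'.
  have jL : (`|(j - N)%R| < L)%N by lia.
  have E : N + (Ordinal jL : nat)%:Z = j by rewrite /=; lia.
  have Jo : `[< J (N + (Ordinal jL : nat)%:Z) >] by rewrite E; exact/asboolP.
  pose w : window N L J := exist _ (Ordinal jL) Jo.
  have := congr1 (fun h : codes N L J => val (h w)) cg.
  have := congr1 (fun h : codes N L J => val (h w)) cg'.
  rewrite !ffunE ifF; last first.
    by apply/eqP => /(congr1 (fun w => nat_of_ord (val w))) /=; rewrite -/i; lia.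
  by rewrite /= -/(nat_of_ord (Ordinal jL)) E => -> ->.
have dg : digit (a g') (N + i%:Z) = ((digit (a g) (N + i%:Z) + 1) %% p)%N.
  have := congr1 (fun h : codes N L J => val (h r)) cg.
  have := congr1 (fun h : codes N L J => val (h r)) cg'.
  by rewrite !ffunE eqxx /= => -> ->.
split=> //; rewrite -[in RHS]modnDml !W_mod // -[LHS](modn_small (W_lt N i.+1 (a g'))).
rewrite !WS (W_agree ag) dg -addnA -[in RHS]mulSnr.
rewrite -[in LHS]modnDmr -[in RHS]modnDmr; congr ((_ + _) %% _)%N.
by rewrite expnS -!muln_modl modn_mod addn1.
Qed.

End Trees.

(** * Homogeneous sets *)

Lemma finite_int_bound (T : choiceType) (F : set T) (h : T -> int) :
  finite_set F -> exists b, forall i, F i -> h i <= b.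
Proof.
move=> /finite_seqP[s ->]; elim: s => [|a s [b bP]]; first by exists 0.
exists (Num.max b (h a)) => i; rewrite /= inE => /orP[/eqP->|/bP]; lia.
Qed.

Lemma card_eq_family (T : pointedType) (A : set T) (k : nat) : (A #= [set: 'I_k])%card ->
  exists f : 'I_k -> T, [/\ injective f, forall i, A (f i) &
    forall a, A a -> exists i, f i = a].
Proof.
rewrite card_eq_sym => /card_set_bijP[f [fA finj fsurj]]; exists f; split.
- by move=> i j; apply: finj; rewrite inE.
- by move=> i; exact: fA.
- by move=> a /fsurj[i _ <-]; exists i.
Qed.

Section Homogeneous.
Variables (p : nat) (p_gt0 : (0 < p)%N).
Hypothesis p_gt1 : (1 < p)%N.
Local Notation QP := (QP_ p_gt0).
Local Notation "0q" := (qp_zero p_gt0).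
Implicit Types (x y z : QP) (N n : int) (k : nat) (J : set int) (Om : set QP).

Lemma qp_ball_open (a : QP) n : qp_open (qp_ball a n).
Proof.
move=> x; rewrite (qp_ballE p_gt1) /= => xa; exists n => y.
rewrite !(qp_ballE p_gt1) /= => yx; exact: agree_trans xa.
Qed.

(** Extract a finite subcover from the balls of radius [p^i] around 0. *)
Lemma qp_compact_bounded Om : qp_compact Om -> exists M, forall x, Om x -> zero_below M x.
Proof.
move=> /(_ nat (fun i => qp_ball 0q (- i%:Z))) [||F [Ffin OF]].
- by move=> i; exact: qp_ball_open.
- move=> x _; have [N Nx] := zero_below_exists x; exists `|N|%N => //.
  by rewrite (qp_ballE p_gt1) /=; apply: zero_below_agree => //; apply: zero_below_le Nx; lia.
have [b bP] := @finite_int_bound nat F Posz Ffin.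
exists (- b) => x /OF[i Fi]; rewrite (qp_ballE p_gt1) /= => xi.
by apply: (@agree_zero_below _ _ _ (- i%:Z) 0q) => //; [have := bP _ Fi; lia|exact: agree_sym].
Qed.

(** A Lebesgue number: finitely many balls inside [Om] cover it, and in an ultrametric space a ball
    of the smallest of their radii around a point of [Om] stays inside one of them. *)
Lemma qp_compact_open_level Om : qp_compact Om -> qp_open Om ->
  exists n0, forall x y, Om x -> agree n0 x y -> Om y.
Proof.
move=> cO oO.
have [||F [Ffin OF]] := cO (QP * int)%type
  (fun i => [set x | qp_ball i.1 i.2 x /\ qp_ball i.1 i.2 `<=` Om]).
- move=> i x [xi iO]; have [n nP] := qp_ball_open xi; exists n => y /nP yi.
  by split.
- move=> x Ox; have [n nO] := oO _ Ox; exists (x, n) => //=; split=> //.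
  by rewrite (qp_ballE p_gt1) /=.
have [b bP] := @finite_int_bound (QP * int)%type F snd Ffin.
exists b => x y /OF[[a n] Fi [/= xa aO]] xy; apply: aO; move: xa.
rewrite (qp_ballE p_gt1) /= => xa; apply: agree_trans xa.
by apply: agree_sym; apply: agree_le xy; exact: bP Fi.
Qed.

Lemma adm_ordersP Om n : adm_orders Om n <->
  exists x y, [/\ Om x, Om y, agree n x y & digit x n <> digit y n].
Proof.
split=> [[x [y [Ox [Oy [xy v]]]]]|[x [y [Ox Oy xy dxy]]]]; exists x, y.
  by have [] := (vp_subP p_gt1 x y n).1 (conj xy v).
by have [] := (vp_subP p_gt1 x y n).2 (conj xy dxy).
Qed.

(** At an admissible order [n] some ball splits, which rules out the alternative with one sub-ball.
    The [p] sub-balls around [s] then contain points of [Om] with distinct digits at [n], hence with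
    all digits. *)
Lemma homogeneous_tree Om : p_homogeneous Om -> Om !=set0 -> tree (adm_orders Om) Om.
Proof.
move=> hO O0; split=> //.
  move=> x y n Ox Oy xy nI; apply: contrapT => dxy; apply: nI.
  by apply/adm_ordersP; exists x, y.
move=> s n d Os nI dp.
have nb x m : Om x -> Nballs Om m (qp_ball x m).
  by move=> Ox; exists x; split=> //; exists x; split=> //; rewrite (qp_ballE p_gt1).
have sub x y m : agree m x y -> qp_ball x (m + 1) `<=` qp_ball y m.
  move=> xy z; rewrite !(qp_ballE p_gt1) /= => zx; apply: agree_trans xy.
  by apply: agree_le zx; lia.
have [h|h] := hO n.
  have /adm_ordersP[x [y [Ox Oy xy dxy]]] := nI.
  have [f [_ _ fsurj]] := card_eq_family (h _ (nb x n Ox)).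
  have [|i fi] := fsurj (qp_ball x (n + 1)); first by split; [exact: nb|exact: sub].
  have [|j fj] := fsurj (qp_ball y (n + 1)).
    by split; [exact: nb|apply: sub; exact: agree_sym].
  have : qp_ball y (n + 1) x.
    by rewrite -fj (ord1 j) -(ord1 i) fi (qp_ballE p_gt1).
  by rewrite (qp_ballE p_gt1) /= => /(_ n) e; case: dxy; apply: e; lia.
have [f [finj fA _]] := card_eq_family (h _ (nb s n Os)).
have rep i : exists x, [/\ Om x, f i = qp_ball x (n + 1) & agree n s x].
  have [[a [fi [x [ax Ox]]]] fs] := fA i; exists x; split=> //.
    rewrite fi !(qp_ballE p_gt1); move: ax; rewrite fi (qp_ballE p_gt1) /= => ax.
    apply/seteqP; split=> y /= ya; first exact: agree_trans ya (agree_sym ax).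
    exact: agree_trans ya ax.
  by move: (fs _ ax); rewrite (qp_ballE p_gt1) /=; exact: agree_sym.
have [r rP] := choice rep.
pose e i : 'I_p := Ordinal (digit_lt (r i) n).
have einj : injective e.
  move=> i j /(congr1 val) /= dij; apply: finj.
  have [_ -> si] := rP i; have [_ -> sj] := rP j.
  have ij : agree (n + 1) (r i) (r j).
    by apply: agreeS => //; apply: agree_trans (agree_sym si) sj.
  rewrite !(qp_ballE p_gt1); apply/seteqP; split=> y /= ya.
    exact: agree_trans ya ij.
  exact: agree_trans ya (agree_sym ij).
have [g _ eg] := injF_bij einj.
have [Or _ sr] := rP (g (Ordinal dp)).
exists (r (g (Ordinal dp))); split=> //.
by have := congr1 val (eg (Ordinal dp)).
Qed.

End Homogeneous.

(** * Exponential sums *)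

Section Cyclotomic.
Variable p : nat.
Hypothesis hp : prime p.

(** The cyclotomic polynomial of order [p^{k+1}]. *)
Definition Phi_pow (F : nzRingType) (k : nat) : {poly F} := \sum_(j < p) 'X^(j * p ^ k).

Lemma Phi_pow_root (F : fieldType) k (z : F) : (p ^ k.+1).-primitive_root z ->
  root (Phi_pow F k) z.
Proof.
move=> zP; set y := z ^+ (p ^ k).
have y1 : y != 1.
  rewrite -(prim_order_dvd zP) expnS -{2}[(p ^ k)%N]mul1n.
  rewrite dvdn_pmul2r ?expn_gt0 ?prime_gt0 // dvdn1; have := prime_gt1 hp; lia.
have yp : y ^+ p = 1 by rewrite -exprM mulnC -expnS prim_expr_order.
rewrite /root /Phi_pow horner_sum.
have -> : \sum_(j < p) ('X^(j * p ^ k)).[z] = \sum_(j < p) y ^+ j.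
  by apply: eq_bigr => j _; rewrite hornerXn mulnC exprM.
by have := subrX1 y p; rewrite yp subrr => /esym/eqP; rewrite mulf_eq0 subr_eq0 (negbTE y1).
Qed.

Lemma size_Phi_pow (F : fieldType) k : size (Phi_pow F k) = (p.-1 * p ^ k).+1.
Proof.
rewrite /Phi_pow; case: p (prime_gt0 hp) => // q _ /=; rewrite big_ord_recr /=.
rewrite addrC size_polyDl ?size_polyXn // ltnS.
apply: (leq_trans (size_sum _ _ _)); apply/bigmax_leqP => j _.
rewrite size_polyXn; case: j => j jq /=.
have : (0 < q.+1 ^ k)%N by rewrite expn_gt0.
nia.
Qed.

(** Comparing degrees in [algC] identifies [Phi_pow] with the minimal polynomial [f] of a primitive
    root [w]. Over the rationals, [gcdp P f] has the root [z], so it is not constant; a size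
    argument excludes [w] from the roots of the cofactor, hence [f] divides the gcd. *)
Lemma Phi_pow_dvd (K : numFieldType) k (z : K) (P : {poly rat}) :
  (p ^ k.+1).-primitive_root z -> root (map_poly ratr P) z -> Phi_pow _ k %| P.
Proof.
move=> zP Pz; have n_gt0 : (0 < p ^ k.+1)%N by rewrite expn_gt0 prime_gt0.
have [w wP] := C_prim_root_exists n_gt0.
have [f [fE fmon] fdvd] := minCpolyP w.
have mapPhi (K' : numFieldType) : map_poly ratr (Phi_pow rat k) = Phi_pow K' k.
  by rewrite /Phi_pow rmorph_sum; apply: eq_bigr => j _; rewrite /= map_polyXn.
have fPhi : f %= Phi_pow _ k.
  rewrite -dvdp_size_eqp; last by rewrite -fdvd mapPhi Phi_pow_root.
  rewrite size_Phi_pow -(size_map_poly (@ratr algC)) -fE (minCpoly_cyclotomic wP).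
  by rewrite size_cyclotomic totient_pfactor //= mulnC.
rewrite -(eqp_dvdl _ fPhi).
pose g := gcdp P f.
have gz : root (map_poly ratr g) z.
  rewrite gcdp_map root_gcd Pz /=.
  have := eqp_map (@ratr K) f (Phi_pow _ k); rewrite fPhi mapPhi => /eqp_root ->.
  exact: Phi_pow_root.
have /dvdpP[h fgh] : g %| f by exact: dvdp_gcdr.
have f0 : f != 0 by rewrite monic_neq0.
have : root (map_poly ratr f) w by rewrite fdvd.
rewrite {1}fgh rmorphM rootM => /orP[|]; rewrite fdvd => fh; last first.
  by apply: dvdp_trans fh _; exact: dvdp_gcdl.
exfalso.
have h0 : h != 0 by apply: contraNneq f0 => h0; rewrite fgh h0 mul0r.
have g0 : g != 0 by apply: contraNneq f0 => g0; rewrite fgh g0 mulr0.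
have := dvdp_leq h0 fh; rewrite fgh size_mul // => sz.
have g1 : (1 < size g)%N.
  rewrite -(size_map_poly (@ratr K)); apply: root_size_gt1 gz.
  by rewrite map_poly_eq0.
move: sz g1 h0; rewrite -size_poly_gt0; move: (size h) (size g) => a b; clear.
by lia.
Qed.

(** The relation is a multiple [Q * Phi_pow] with [size Q <= p ^ k]. The shifted copies of [Q] do
    not overlap, so the coefficients repeat with period [p ^ k]. *)
Lemma root_of_unity_relation (K : numFieldType) k (z : K) (c : nat -> nat) :
  (p ^ k.+1).-primitive_root z -> \sum_(i < p ^ k.+1) (c i)%:R * z ^+ i = 0 ->
  forall i j, (i < p ^ k.+1)%N -> (j < p ^ k.+1)%N -> i = j %[mod p ^ k] -> c i = c j.
Proof.
move=> zP cz; set n := (p ^ k.+1)%N.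
pose P : {poly rat} := \poly_(i < n) (c i)%:R.
have /(Phi_pow_dvd zP)/dvdpP[Q PQ] : root (map_poly ratr P) z.
  have -> : map_poly ratr P = \poly_(i < n) (c i)%:R :> {poly K}.
    apply/polyP => i; rewrite coef_map !coef_poly.
    by case: ifP => _; [exact: ratr_nat|exact: rmorph0].
  by rewrite /root horner_poly cz.
have pk : (0 < p ^ k)%N by rewrite expn_gt0 prime_gt0.
have sQ : (size Q <= p ^ k)%N.
  have [->|Q0] := eqVneq Q 0; first by rewrite size_poly0.
  have Phi0 : Phi_pow rat k != 0 by rewrite -size_poly_gt0 size_Phi_pow.
  have : (size P <= n)%N by exact: size_poly.
  rewrite PQ size_mul // size_Phi_pow /n expnS addnS /=.
  have -> : (p * p ^ k = p ^ k + p.-1 * p ^ k)%N by rewrite -mulSn prednK ?prime_gt0.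
  by rewrite leq_add2r.
have coefP i : (i < n)%N -> (c i)%:R = Q`_(i %% p ^ k).
  move=> iin; have -> : (c i)%:R = P`_i by rewrite coef_poly iin.
  rewrite PQ /Phi_pow mulr_sumr coef_sum.
  have jp : (i %/ p ^ k < p)%N by rewrite ltn_divLR // -expnS.
  rewrite (bigD1 (Ordinal jp)) //= coefMXn ltnNge leq_trunc_div /=.
  rewrite {1}(divn_eq i (p ^ k)) addKn big1 ?addr0 // => j jne.
  rewrite coefMXn; case: ltnP => // ji; apply: nth_default; apply: leq_trans sQ _.
  have {}jne : (j < i %/ p ^ k)%N.
    rewrite ltn_neqAle leq_divRL // ji andbT.
    by apply: contraNneq jne => jE; apply/eqP/val_inj.
  have := divn_eq i (p ^ k); nia.
move=> i j ii jj ij; have := coefP i ii; rewrite ij -coefP //.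
by move/eqP; rewrite eqr_nat => /eqP.
Qed.

End Cyclotomic.

(** * The exponential of a rational number *)

Section Exponential.
Variable R : realType.
Implicit Types q : rat.

Definition E q : R[i] := Complex (cos (2 * pi * ratr q)) (sin (2 * pi * ratr q)).

Lemma E0 : E 0 = 1.
Proof. by rewrite /E rmorph0 mulr0 cos0 sin0. Qed.

Lemma E_add q q' : E (q + q') = E q * E q'.
Proof.
by rewrite /E rmorphD mulrDr cosD sinD; apply/eqP; rewrite eq_complex /= eqxx /= addrC.
Qed.

Lemma E_nat (n : nat) : E n%:R = 1.
Proof.
elim: n => [|n IH]; first exact: E0.
rewrite -addn1 natrD E_add IH mul1r /E rmorph1 mulr1 mulr_natl cos2pi sin2pi.
by [].
Qed.

Lemma E_opp q : E q * E (- q) = 1.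
Proof. by rewrite -E_add subrr E0. Qed.

Lemma E_int (c : int) : E c%:~R = 1.
Proof.
case: c => n; first exact: E_nat.
by rewrite NegzE mulrNz; have := E_opp n.+1%:R; rewrite E_nat mul1r.
Qed.

Lemma E_addint q (c : int) : E (q + c%:~R) = E q.
Proof. by rewrite E_add E_int mulr1. Qed.

Lemma E_exp q (n : nat) : E q ^+ n = E (q * n%:R).
Proof.
elim: n => [|n IH]; first by rewrite mulr0 E0 expr0.
by rewrite exprSr IH -E_add -natr1 mulrDr mulr1.
Qed.

(** With [f] the part of [q] in [[0, 1)], the double angle formula turns [cos (2 pi f) = 1] into
    [sin (pi f) = 0], which is impossible for [0 < f < 1]. *)
Lemma E_eq1 q : E q = 1 -> exists c : int, q = c%:~R.
Proof.
move=> Eq; exists (Num.floor q); apply/eqP; rewrite eq_sym -subr_eq0 -oppr_eq0 opprB.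
set f := q - _; apply: contraT => f0.
have f_ge0 : 0 <= f by rewrite subr_ge0 ge_floor.
have f_lt1 : f < 1 by have := lt_succ_floor q; rewrite intrD ltrBlDl.
have {f0 f_ge0}f_gt0 : 0 < f by rewrite lt_neqAle eq_sym f0.
have : E f = 1 by rewrite /f -mulrNz E_addint.
rewrite /E => -[+ _]; rewrite -mulrA mulr_natl cos_mulr2n => c1.
set t := pi * _ in c1.
have t_gt0 : 0 < t by rewrite mulr_gt0 ?pi_gt0 // ltr0q.
have t_ltpi : t < pi by rewrite gtr_pMr ?pi_gt0 // -(rmorph1 (@ratr R)) ltr_rat.
have := @sin_gt0_pi R t; rewrite t_gt0 t_ltpi => /(_ isT) s0.
have := sin2cos2 t; have -> : cos t ^+ 2 = 1 by lra.
rewrite subrr => /eqP; rewrite expf_eq0 /= => /eqP s00.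
by rewrite s00 ltxx in s0.
Qed.

End Exponential.

(** * Vanishing sums of roots of unity of [p]-power order *)

Section ExponentialSums.
Variables (R : realType) (p : nat).
Hypothesis hp : prime p.
Local Notation E := (E R).
Let p0 : (p%:R : rat) != 0. Proof. by rewrite pnatr_eq0; have := prime_gt0 hp; lia. Qed.

Lemma E_primitive (d : int) k : ~~ (p %| d)%Z ->
  (p ^ k.+1).-primitive_root (E (d%:~R / (p ^ k.+1)%:R)).
Proof.
move=> pd; set n := (p ^ k.+1)%N.
have n_gt0 : (0 < n)%N by rewrite expn_gt0 prime_gt0.
have n0 : (n%:R : rat) != 0 by rewrite pnatr_eq0 -lt0n.
have zn : E (d%:~R / n%:R) ^+ n = 1 by rewrite E_exp divfK // E_int.
have [m mP mn] := prim_order_exists n_gt0 zn.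
suff nm : (n %| m)%N.
  have e : m = n by apply/eqP; rewrite eqn_dvd nm mn.
  by rewrite -{1}e.
have := prim_expr_order mP; rewrite E_exp => /E_eq1[c].
move=> /(congr1 (fun x => x * n%:R)); rewrite mulrAC divfK // => e.
have {}e : d * m%:Z = c * n%:Z.
  by apply/eqP; rewrite -(eqr_int rat) !rmorphM /= e.
have : (n%:Z %| d * m%:Z)%Z by rewrite e dvdz_mull.
rewrite Gauss_dvdzr; first by rewrite dvdzE.
rewrite /n coprimezE /= coprime_pexpl // prime_coprime //.
Qed.

(** Each term only sees [w g] modulo [p ^ r.+1], so reindexing by [t] multiplies the sum by
    [E (d / p)], which is not 1 since [p] does not divide [d]. *)
Lemma exp_sum_eq0 (F : finType) (c : F -> R[i]) (w : F -> nat) (t : F -> F)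
    (r L : nat) (d : int) :
  (r < L)%N -> injective t -> (forall g, c (t g) = c g) ->
  (forall g, w (t g) = w g + p ^ r %[mod p ^ r.+1])%N -> ~~ (p %| d)%Z ->
  \sum_g c g * E ((p ^ (L - r.+1))%:R * d%:~R * (w g)%:R / (p ^ L)%:R) = 0.
Proof.
move=> rL tinj ct tw pd.
have e0 m : ((p ^ m)%:R : rat) != 0 by rewrite natrX expf_neq0.
have simp g : E ((p ^ (L - r.+1))%:R * d%:~R * (w g)%:R / (p ^ L)%:R) =
    E (d%:~R * (w g)%:R / (p ^ r.+1)%:R).
  congr E; rewrite -[in (p ^ L)%N](subnK rL) expnD natrM.
  move: (e0 (L - r.+1)%N) (e0 r.+1); move: (_%:R : rat) (_%:R : rat) => a b a0 b0.
  by field; rewrite a0 b0.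
under eq_bigr do rewrite simp.
set s := \sum_g _.
have zs : s = s * E (d%:~R / p%:R).
  rewrite {1}/s (reindex_inj tinj) /= mulr_suml; apply: eq_bigr => g _.
  rewrite ct -[RHS]mulrA; congr (_ * _).
  have [a [b ab]] : exists a b : nat, (w (t g) + a * p ^ r.+1 = w g + p ^ r + b * p ^ r.+1)%N.
    exists ((w g + p ^ r) %/ p ^ r.+1)%N, (w (t g) %/ p ^ r.+1)%N.
    by rewrite {1}(divn_eq (w (t g)) (p ^ r.+1)) tw {3}(divn_eq (w g + p ^ r) (p ^ r.+1)); lia.
  have ab' : (w (t g))%:R = (w g)%:R + (p ^ r)%:R + (b%:R - a%:R) * (p ^ r.+1)%:R :> rat.
    move/(congr1 (fun x => x%:R : rat)): ab; rewrite !natrD !natrM => ab; lra.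
  rewrite ab' -E_add.
  have -> : d%:~R * ((w g)%:R + (p ^ r)%:R + (b%:R - a%:R) * (p ^ r.+1)%:R) / (p ^ r.+1)%:R
     = d%:~R * (w g)%:R / (p ^ r.+1)%:R + d%:~R / p%:R + (d * (b%:Z - a%:Z))%:~R :> rat.
    rewrite rmorphM rmorphB /= -!pmulrn expnS natrM; field.
    by rewrite e0 p0.
  by rewrite E_addint.
apply: contraNeq pd => s0.
have : E (d%:~R / p%:R) = 1 by apply: (mulfI s0); rewrite -zs mulr1.
move=> /E_eq1[k] /(congr1 (fun x => x * p%:R)); rewrite divfK // => e.
have -> : d = k * p%:Z by apply/eqP; rewrite -(eqr_int rat) rmorphM /= e.
by rewrite dvdz_mull.
Qed.

(** Grouping by residue gives a relation among powers of a primitive root whose coefficients count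
    the [g] in each class. These counts have period [p ^ r], so the class of [w g0 + p ^ r] is
    occupied like that of [w g0]. *)
Lemma exp_sum_eq0_split (F : finType) (w : F -> nat) (g0 : F) (r L : nat) (d : int) :
  (r < L)%N -> ~~ (p %| d)%Z ->
  \sum_g E ((p ^ (L - r.+1))%:R * d%:~R * (w g)%:R / (p ^ L)%:R) = 0 ->
  exists g g', w g = w g' %[mod p ^ r] /\ w g <> w g' %[mod p ^ r.+1].
Proof.
move=> rL pd s0; set n := (p ^ r.+1)%N.
have e0 m : ((p ^ m)%:R : rat) != 0 by rewrite natrX expf_neq0.
have n_gt0 : (0 < n)%N by rewrite expn_gt0 prime_gt0.
pose z := E (d%:~R / n%:R); have zP : n.-primitive_root z by exact: E_primitive.
have simp g : E ((p ^ (L - r.+1))%:R * d%:~R * (w g)%:R / (p ^ L)%:R) = z ^+ (w g %% n)%N.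
  rewrite prim_expr_mod // E_exp; congr E.
  rewrite -[in (p ^ L)%N](subnK rL) expnD natrM -/n.
  move: (e0 (L - r.+1)%N) (e0 r.+1); rewrite -/n; move: (_%:R : rat) (_%:R : rat) => a b a0 b0.
  by field; rewrite a0 b0.
pose c (i : nat) := #|[pred g | (w g %% n)%N == i]|.
have cz : \sum_(i < n) (c i)%:R * z ^+ i = 0.
  rewrite -[RHS]s0 [RHS](partition_big (fun g => Ordinal (ltn_pmod (w g) n_gt0)) xpredT) //=.
  apply: eq_bigr => i _; rewrite /c -sum1_card natr_sum mulr_suml.
  rewrite [LHS](eq_bigl (fun g => Ordinal (ltn_pmod (w g) n_gt0) == i)); last first.
    by move=> g; rewrite inE.
  by apply: eq_bigr => g /eqP gi; rewrite mul1r simp; congr (_ ^+ _); rewrite -gi.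
have cper := root_of_unity_relation hp zP cz.
pose i := (w g0 %% n)%N; pose j := ((i + p ^ r) %% n)%N.
have iin : (i < n)%N by rewrite ltn_pmod.
have jn : (j < n)%N by rewrite ltn_pmod.
have dvd : (p ^ r %| n)%N by rewrite dvdn_exp2l.
have ij : i = j %[mod p ^ r] by rewrite /j modn_dvdm // modnDr.
have : (0 < c j)%N.
  rewrite -(cper _ _ iin jn ij) /c; apply/card_gt0P; exists g0.
  by rewrite inE.
move=> /card_gt0P[g]; rewrite inE => /eqP gj.
exists g0, g; split.
  by rewrite -(modn_dvdm (w g0) dvd) -(modn_dvdm (w g) dvd) gj -/i.
rewrite -/n gj -/i => ijE.
have : (i + p ^ r = i + 0 %[mod n])%N by rewrite addn0 -/j -ijE modn_small.
move/eqP; rewrite eqn_modDl mod0n modn_small ?expn_eq0 ?ltn_exp2l ?prime_gt1 //.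
by have := prime_gt0 hp; lia.
Qed.

End ExponentialSums.

(** * Tijdeman's lemma *)

Section Tijdeman.
Local Open Scope nat_scope.
Variables (n : nat) (A B : finType).
Hypotheses (n_gt0 : 0 < n) (cardAB : #|A| * #|B| = n).

Definition direct_mod (a : A -> nat) (b : B -> nat) := forall x x' y y',
  a x + b y = a x' + b y' %[mod n] -> x = x' /\ y = y'.

(** Over the field with [q] elements, modulo [X^n - 1], a tiling reads [A B = G] with
    [G = 1 + ... + X^{n-1}], and [A G = |A| G]. Hence [A(X^q) B = A^{q-1} A B = |A|^{q-1} G]. As [q]
    does not divide [|A|], every residue is hit, and by counting exactly once. *)
Lemma tijdeman_prime (a : A -> nat) (b : B -> nat) (q : nat) : prime q -> coprime q n ->
  direct_mod a b -> direct_mod (fun x => q * a x) b.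
Proof.
move=> qpr qn ab; pose K := 'F_q.
have qK : q \in [pchar {poly K}].
  by rewrite inE qpr /= -polyC1 -polyC_natr polyC_eq0 (pcharf0 (pchar_Fp qpr)).
pose D : {poly K} := ('X^n - 1)%R.
have sizeD : size D = n.+1 by rewrite size_Xn_sub_1.
pose res (c : A * B) (u : A -> nat) : 'I_n := Ordinal (ltn_pmod (u c.1 + b c.2) n_gt0).
have cardI : #|{: A * B}| = #|'I_n| by rewrite card_prod card_ord.
pose G : {poly K} := (\sum_(i < n) 'X^i)%R.
have modXn i : ('X^i %% D = 'X^(i %% n) %% D)%R.
  rewrite {1}(divn_eq i n); elim: (i %/ n) => [|k IH]; first by rewrite mul0n.
  have Xn : ('X^n %% D = 1 %% D)%R.
    by rewrite -{1}[('X^n)%R](subrK 1%R) modpD modpp add0r.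
  rewrite mulSn -addnA exprD mulrC -modp_mul Xn modp_mul mulr1.
  exact: IH.
have modsum (I : finType) (f g : I -> {poly K}) : (forall i, f i %% D = g i %% D)%R ->
    ((\sum_i f i) %% D = (\sum_i g i) %% D)%R.
  move=> fg; elim/big_rec2: _ => // i u v _ h.
  by rewrite !modpD fg h.
have XG : ('X * G %% D = G %% D)%R.
  have -> : ('X * G = G + D)%R.
    by have := subrX1 ('X : {poly K}) n; rewrite -/G -/D mulrBl mul1r => ->; rewrite addrC subrK.
  by rewrite modpD modpp addr0.
have XnG i : ('X^i * G %% D = G %% D)%R.
  elim: i => [|i IH]; first by rewrite expr0 mul1r.
  by rewrite exprSr -mulrA -modp_mul XG modp_mul.
pose P (u : A -> nat) : {poly K} := (\sum_x 'X^(u x))%R.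
pose Q : {poly K} := (\sum_y 'X^(b y))%R.
have PQ u : (P u * Q %% D = (\sum_c 'X^(res c u)) %% D)%R.
  rewrite /P /Q big_distrlr /= pair_bigA /=; apply: modsum => c.
  by rewrite -exprD; exact: modXn.
have res_inj : injective (res^~ a).
  by move=> [x y] [x' y'] /(congr1 val) /= /ab[-> ->].
have PaQ : (P a * Q %% D = G %% D)%R.
  rewrite PQ /G [in RHS](reindex (res^~ a)) //=; apply: onW_bij.
  by apply: inj_card_bij res_inj _; rewrite cardI.
have PaG k : (P a ^+ k * G %% D = ((#|A| ^ k)%:R * G) %% D)%R.
  have PG : (P a * G %% D = (#|A|%:R * G) %% D)%R.
    rewrite /P mulr_suml (modsum _ _ (fun=> G)) // sumr_const mulr_natl.
    by congr ((_ *+ _) %% _)%R; apply: eq_card => x; rewrite !inE.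
  elim: k => [|k IH]; first by rewrite expr0 expn0.
  rewrite exprSr -mulrA -modp_mul PG modp_mul mulrCA.
  by rewrite -modp_mul IH modp_mul expnS natrM mulrA.
have Pq : P (fun x => q * a x) = (P a ^+ q)%R.
  rewrite -(pFrobenius_autE qK) /P rmorph_sum; apply: eq_bigr => x _ /=.
  by rewrite pFrobenius_autE -exprM mulnC.
(* The coefficients of [f] count representations of residues. Both sides of [fE] have size at most
   [n], so congruence modulo [D] becomes equality. *)
pose f : {poly K} := (\sum_c 'X^(res c (fun x => q * a x)))%R.
have fE : f = ((#|A| ^ q.-1)%:R * G)%R.
  have sG : size G <= n.
    by apply: leq_trans (size_sum _ _ _) _; apply/bigmax_leqP => i _; rewrite size_polyXn.
  have sf : size f <= n.
    by apply: leq_trans (size_sum _ _ _) _; apply/bigmax_leqP => i _; rewrite size_polyXn.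
  rewrite -[LHS](@modp_small _ _ D) ?sizeD // -[RHS](@modp_small _ _ D); last first.
    rewrite sizeD ltnS; apply: leq_trans sG; rewrite mulr_natl -scaler_nat.
    exact: size_scale_leq.
  have Paq : (P a ^+ q = P a ^+ q.-1 * P a)%R by rewrite -exprSr prednK ?prime_gt0.
  rewrite /f -PQ Pq -PaG Paq -mulrA.
  by rewrite -modp_mul PaQ modp_mul.
have surj z : exists c, res c (fun x => q * a x) = z.
  apply: contrapT => nz.
  have : (f`_z = 0)%R.
    rewrite coef_sum big1 // => c _; rewrite coefXn; case: eqP => // e.
    by case: nz; exists c; apply: val_inj.
  rewrite fE mulr_natl coefMn.
  have -> : (G`_z = 1)%R.
    have -> : G = (\poly_(i < n) 1)%R by rewrite poly_def; apply: eq_bigr => i _; rewrite scale1r.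
    by rewrite coef_poly ltn_ord.
  move/eqP; rewrite -(dvdn_pcharf (pchar_Fp qpr)) Euclid_dvdX // => /andP[qA _].
  have := qn; rewrite prime_coprime // -cardAB => /negP; apply.
  exact: dvdn_mulr.
move=> x x' y y' e.
have rinj : injective (res^~ (fun x => q * a x)).
  have [g gP] := choice surj.
  have ginj : injective g by move=> u v uv; rewrite -(gP u) uv gP.
  have [h hg gh] := inj_card_bij ginj (eq_leq cardI).
  by move=> c c' e'; rewrite -(gh c) -(gh c') -[h c]gP -[h c']gP !gh e'.
have /rinj[-> ->] // : res (x, y) (fun x => q * a x) = res (x', y') (fun x => q * a x).
exact: val_inj.
Qed.

Lemma tijdeman (a : A -> nat) (b : B -> nat) (k : nat) : 0 < k -> coprime k n ->
  direct_mod a b -> direct_mod (fun x => k * a x) b.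
Proof.
elim/ltn_ind: k a => k IH a k0 kn ab.
have [k1|k1] := leqP k 1.
  have -> : k = 1 by lia.
  by move=> x x' y y'; rewrite !mul1n; exact: ab.
have qpr := pdiv_prime k1; set q := pdiv k in qpr.
have qk : q %| k by exact: pdiv_dvd.
have kE := divnK qk.
have k'0 : 0 < k %/ q by rewrite divn_gt0 ?prime_gt0 // dvdn_leq.
have k'n : coprime (k %/ q) n by apply: coprime_dvdl kn; rewrite -{2}kE dvdn_mulr.
have qn : coprime q n by apply: coprime_dvdl kn.
have k'k : k %/ q < k by rewrite ltn_Pdiv ?prime_gt1.
have := IH _ k'k _ k'0 k'n (tijdeman_prime qpr qn ab) => h x x' y y' e.
by apply: h; rewrite !mulnA kE.
Qed.

End Tijdeman.

(** * Exponential sums over trees *)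

Section TreeSums.
Variables (R : realType) (p : nat).
Hypothesis hp : prime p.
Let p_gt0 : (0 < p)%N := prime_gt0 hp.
Let p_gt1 : (1 < p)%N := prime_gt1 hp.
Local Notation QP := (QP_ p_gt0).
Local Notation E := (E R).
Implicit Types (x y l : QP) (N n : int) (J : set int) (S : set QP).

(** Modulo [p] the cofactor [d] is the difference of two distinct digits in [0..p-1]. *)
Lemma W_diff N L i x y : zero_below N x -> zero_below N y -> agree (N + i%:Z) x y ->
  digit x (N + i%:Z) <> digit y (N + i%:Z) -> (i < L)%N ->
  exists2 d : int, ~~ (p %| d)%Z &
    (W N L x)%:R - (W N L y)%:R = (p ^ i)%:R * d%:~R :> rat.
Proof.
move=> Nx Ny xy dxy iL.
have E (z : QP) : W N L z =
    (W N i z + p ^ i * (digit z (N + i%:Z) + p * W (N + i.+1%:Z) (L - i.+1) z))%N.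
  rewrite -{1}(subnKC iL) W_split WS expnS mulnDr addnA [(digit _ _ * _)%N]mulnC mulnA.
  by rewrite [(p ^ i * p)%N]mulnC.
rewrite !E (W_agree xy); set a := digit x _; set b := digit y _.
set c := W (_ + i.+1%:Z) _ x; set e := W (_ + i.+1%:Z) _ y.
exists ((a%:Z - b%:Z) + p%:Z * (c%:Z - e%:Z)).
  rewrite rpredDr; last by rewrite dvdz_mulr.
  apply/negP => /dvdzP[k kE].
  have := digit_lt x (N + i%:Z); have := digit_lt y (N + i%:Z); rewrite -/a -/b => bp ap.
  have k0 : k = 0 by nia.
  by apply: dxy; rewrite -/a -/b; lia.
rewrite !natrD !natrM !natrD !natrM rmorphD rmorphM !rmorphB /= -!pmulrn.
by ring.
Qed.

(** A first difference of [x] and [y] at index [i] detects index [L - i.+1] of [a g]; this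
    reflection is the duality of orders. If that position branches, raising its digit kills the sum,
    and a weight reading only lower digits is invariant under that change. *)
Lemma tree_weighted_exp_sum J S N N' L i (a : codes p N L J -> QP)
    (c : codes p N L J -> R[i]) x y :
  ord_in J S -> (forall g, [/\ S (a g), zero_below N (a g) & dcode N L J (a g) = g]) ->
  (forall g g', agree (N + (L - i.+1)%N%:Z) (a g) (a g') -> c g = c g') ->
  zero_below N' x -> zero_below N' y -> agree (N' + i%:Z) x y ->
  digit x (N' + i%:Z) <> digit y (N' + i%:Z) -> (i < L)%N ->
  J (N + (L - i.+1)%N%:Z) ->
  \sum_g c g * E (((W N' L x)%:R - (W N' L y)%:R) * (W N L (a g))%:R / (p ^ L)%:R) = 0.
Proof.
move=> oS aP ca Nx Ny xy dxy iL Jr.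
have [d pd ->] := W_diff Nx Ny xy dxy iL.
have rL : (L - i.+1 < L)%N by lia.
have Jr' : `[< J (N + (Ordinal rL : nat)%:Z) >] by exact/asboolP.
have [t tinj tW] := W_code_shift (exist _ (Ordinal rL) Jr') oS aP.
have {1}-> : i = (L - (L - i.+1).+1)%N by lia.
apply: (exp_sum_eq0 hp rL tinj _ _ pd) => g; last exact: (tW g).2.
by apply/esym/ca; exact: (tW g).1.
Qed.

Lemma tree_exp_sum J S N N' L i (a : codes p N L J -> QP) x y :
  ord_in J S -> (forall g, [/\ S (a g), zero_below N (a g) & dcode N L J (a g) = g]) ->
  zero_below N' x -> zero_below N' y -> agree (N' + i%:Z) x y ->
  digit x (N' + i%:Z) <> digit y (N' + i%:Z) -> (i < L)%N ->
  J (N + (L - i.+1)%N%:Z) ->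
  \sum_g E (((W N' L x)%:R - (W N' L y)%:R) * (W N L (a g))%:R / (p ^ L)%:R) = 0.
Proof.
move=> oS aP Nx Ny xy dxy iL Jr.
rewrite -[RHS](tree_weighted_exp_sum (c := fun=> 1) oS aP _ Nx Ny xy dxy iL Jr) //.
by apply: eq_bigr => g _; rewrite mul1r.
Qed.

Lemma tree_exp_sum_conv J S N N' L i (a : codes p N L J -> QP) x y :
  (forall g, [/\ S (a g), zero_below N (a g) & dcode N L J (a g) = g]) ->
  zero_below N' x -> zero_below N' y -> agree (N' + i%:Z) x y ->
  digit x (N' + i%:Z) <> digit y (N' + i%:Z) -> (i < L)%N ->
  \sum_g E (((W N' L x)%:R - (W N' L y)%:R) * (W N L (a g))%:R / (p ^ L)%:R) = 0 ->
  exists s s' : QP, [/\ S s, S s', agree (N + (L - i.+1)%N%:Z) s s' &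
    digit s (N + (L - i.+1)%N%:Z) <> digit s' (N + (L - i.+1)%N%:Z)].
Proof.
move=> aP Nx Ny xy dxy iL.
have [d pd ->] := W_diff Nx Ny xy dxy iL; set r := (L - i.+1)%N.
have rL : (r < L)%N by rewrite /r; lia.
have {1}-> : i = (L - r.+1)%N by rewrite /r; lia.
move=> /(exp_sum_eq0_split hp [ffun=> Ordinal p_gt0] rL pd)[g [g' []]].
rewrite !W_mod ?(ltnW rL) //.
have [Sg Ng _] := aP g; have [Sg' Ng' _] := aP g' => Wr WrS.
have ag := W_inj Ng Ng' Wr.
exists (a g), (a g'); split=> // dg; apply: WrS.
apply: W_agree; have -> : N + r.+1%:Z = N + r%:Z + 1 by lia.
exact: agreeS.
Qed.

(** * Characters with frequency in [p^{-n} Z_p], on [p^M Z_p] *)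

Section Characters.
Variables (M n : int) (L : nat).
Hypothesis nE : n = M + L%:Z.

Definition char_value l x : R[i] := E ((W (- n) L l)%:R * (W M L x)%:R / (p ^ L)%:R).

Lemma E_theta l x : zero_below (- n) l -> zero_below M x ->
  Complex (cos (theta R l x)) (sin (theta R l x)) = char_value l x.
Proof.
move=> nl Mx; have [c cE] := frac_mul p_gt1 nl Mx nE.
by rewrite /char_value natrX -(E_addint _ _ c) -cE.
Qed.

Lemma E_thetaB l l' x x' : zero_below (- n) l -> zero_below (- n) l' -> zero_below M x -> zero_below M x' ->
  Complex (cos (theta R l x - theta R l' x')) (sin (theta R l x - theta R l' x')) =
  E (((W (- n) L l)%:R * (W M L x)%:R - (W (- n) L l')%:R * (W M L x')%:R) / (p ^ L)%:R).
Proof.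
move=> nl nl' Mx Mx'.
have [c cE] := frac_mul p_gt1 nl Mx nE; have [c' cE'] := frac_mul p_gt1 nl' Mx' nE.
rewrite /theta -mulrBr -rmorphB -/(E _) cE cE' natrX.
by rewrite opprD addrACA -mulrBl -rmorphB /= E_addint.
Qed.

Lemma theta_agree l x y : zero_below (- n) l -> zero_below M x -> zero_below M y -> agree n x y ->
  cos (theta R l x) = cos (theta R l y) /\ sin (theta R l x) = sin (theta R l y).
Proof.
move=> nl Mx My xy; have := E_theta nl Mx.
by rewrite /char_value (W_agree (_ : agree (M + L%:Z) x y)) -?nE // -/(char_value l y) -E_theta // => -[].
Qed.

End Characters.
End TreeSums.

(** * Integrals of step functions *)

Section Integration.
Variables (R : realType) (p : nat).
Hypothesis hp : prime p.
Let p_gt0 : (0 < p)%N := prime_gt0 hp.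
Let p_gt1 : (1 < p)%N := prime_gt1 hp.
Local Notation QP := (QP_ p_gt0).
Local Notation QPm := (QPm p_gt0).
Variable m : {measure set QPm -> \bar R}.
Hypothesis Hm : haar_measure m.

Lemma qp_ball_measurable (x : QP) (n : int) : measurable (qp_ball x n : set QPm).
Proof. by apply: sub_sigma_algebra; exists x, n. Qed.

Lemma indic_ball_agree (c x y : QP) (k : int) : agree k x y ->
  \1_(qp_ball c k : set QPm) x = \1_(qp_ball c k : set QPm) y :> R.
Proof.
move=> xy; rewrite !indicE; congr (_%:R : R); congr nat_of_bool.
rewrite (qp_ballE p_gt1); apply/idP/idP => /set_mem /= h; apply/mem_set => /=.
  exact: agree_trans (agree_sym xy) h.
exact: agree_trans xy h.
Qed.

(** A ball has positive measure, so no null set contains it. *)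
Lemma ae_ball (P : QPm -> Prop) (c : QP) (n : int) : {ae m, forall x, P x} ->
  exists x, agree n x c /\ P x.
Proof.
move=> [A [mA A0 PA]]; apply: contrapT => nP.
have BA : (qp_ball c n : set QPm) `<=` A.
  move=> x; rewrite (qp_ballE p_gt1) /= => xc; apply: PA => /= Px.
  by apply: nP; exists x.
have : (m (qp_ball c n) <= m A)%E.
  by apply: le_measure BA; rewrite inE //; exact: qp_ball_measurable.
rewrite A0 Hm lee_fin leNgt => /negP; apply.
by rewrite exprz_gt0 ?ltr0n.
Qed.

Variables (I : set int) (Om : set QPm) (M n : int) (L : nat) (a : codes p M L I -> QP).
Hypothesis nE : n = M + L%:Z.
Hypothesis oO : ord_in I Om.
Hypothesis OM : forall x, Om x -> zero_below M x.
Hypothesis On : forall x y, Om x -> agree n x y -> Om y.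
Hypothesis aP : forall g, [/\ Om (a g), zero_below M (a g) & dcode M L I (a g) = g].

Lemma rep_agree (x : QP) : Om x -> agree n x (a (dcode M L I x)).
Proof.
move=> Ox; rewrite nE; have [Og Mg cg] := aP (dcode M L I x).
by apply: (code_inj oO) => //; exact: OM.
Qed.

Lemma rep_inj (x : QP) g : agree n x (a g) -> g = dcode M L I x.
Proof.
move=> xg; have [_ _ <-] := aP g; apply/codeP => j Mj jn Ij.
by rewrite xg // nE.
Qed.

(** One ball per code, centred at its representative. Together with [disj] this turns integrals of
    step functions into sums over codes. *)
Let cover : Om = \big[setU/set0]_(g <- index_enum (codes p M L I)) (qp_ball (a g) n : set QPm).
Proof.
rewrite -bigcup_seq; apply/seteqP; split=> [x Ox|x [g _]].
  exists (dcode M L I x); first exact: mem_index_enum.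
  by rewrite (qp_ballE p_gt1); exact: rep_agree.
rewrite (qp_ballE p_gt1) => /= xg; have [Og _ _] := aP g.
by apply: On Og _; exact: agree_sym.
Qed.

Let disj : trivIset [set` index_enum (codes p M L I)] (fun g => qp_ball (a g) n : set QPm).
Proof.
move=> g h _ _ [x []]; rewrite !(qp_ballE p_gt1) => /= xg xh.
by rewrite (rep_inj xg) (rep_inj xh).
Qed.

Lemma Om_measurable : measurable Om.
Proof. by rewrite cover; apply: bigsetU_measurable => g _; exact: qp_ball_measurable. Qed.

Definition step (f : QPm -> R) := forall x y, Om x -> Om y -> agree n x y -> f x = f y.

Lemma step_sum f : step f -> forall x, Om x ->
  f x = \sum_g f (a g) * \1_(qp_ball (a g) n : set QPm) x.
Proof.
move=> sf x Ox; rewrite (bigD1 (dcode M L I x)) //= big1 => [|g gx].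
  rewrite indicE mem_set ?mulr1 ?addr0; last first.
    by rewrite (qp_ballE p_gt1); exact: rep_agree.
  apply: sf => //; last exact: rep_agree.
  by have [] := aP (dcode M L I x).
rewrite indicE memNset ?mulr0 // (qp_ballE p_gt1) /= => /rep_inj gE.
by rewrite gE eqxx in gx.
Qed.

Lemma step_measurable f : step f -> measurable_fun Om f.
Proof.
move=> sf; apply: (eq_measurable_fun (fun x => \sum_g f (a g) * \1_(qp_ball (a g) n : set QPm) x)).
  by move=> x /set_mem Ox; rewrite [RHS]step_sum.
apply: measurable_sum => g; apply: measurable_funM => //.
exact: measurable_indic (qp_ball_measurable _ _).
Qed.

Lemma step_bounded f : step f -> [bounded f x | x in Om].
Proof.
move=> sf; exists (\sum_g `|f (a g)|); split; first exact: num_real.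
move=> r rlt x Ox; apply: le_trans (ltW rlt).
have [Og _ _] := aP (dcode M L I x).
rewrite (sf x (a (dcode M L I x))) //; last exact: rep_agree.
by rewrite (bigD1 (dcode M L I x)) //= lerDl sumr_ge0.
Qed.

Lemma step_integral f : step f ->
  (\int[m]_(x in Om) (f x)%:E)%E = (\sum_g f (a g) * (p%:R : R) ^ (- n))%:E.
Proof.
move=> sf; rewrite {1}cover integral_bigsetU_EFin //=; first last.
- by rewrite -cover; apply/measurable_EFinP; exact: step_measurable.
- exact: index_enum_uniq.
- by move=> g; exact: qp_ball_measurable.
rewrite -sumEFin; apply: eq_bigr => g _.
rewrite (eq_integral (fun=> (f (a g))%:E)).
  by rewrite integral_cst ?Hm ?EFinM //; exact: qp_ball_measurable.
move=> x /set_mem; rewrite (qp_ballE p_gt1) => /= xg; congr EFin; have [Og _ _] := aP g.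
by apply: sf => //; apply: On Og _; exact: agree_sym.
Qed.

Lemma Om_measure : m Om = (#|{: codes p M L I}|%:R * (p%:R : R) ^ (- n))%:E.
Proof.
have := integral_cst m Om_measurable 1; rewrite mul1e => <-.
rewrite (@step_integral (fun=> 1)) //; under eq_bigr do rewrite mul1r.
rewrite sumr_const mulr_natl; congr (EFin (_ *+ _)).
Qed.

Lemma Om_finite : (m Om < +oo)%E.
Proof. by rewrite Om_measure ltry. Qed.

Lemma step_integrable f : step f -> m.-integrable Om (EFin \o f).
Proof.
move=> sf; apply: measurable_bounded_integrable.
- exact: Om_measurable.
- exact: Om_finite.
- exact: step_measurable.
- exact: step_bounded.
Qed.

Lemma step_cos (l : QP) : zero_below (- n) l -> step (fun x => cos (theta R l x)).
Proof.
by move=> nl x y Ox Oy xy; have [] := theta_agree R nE nl (OM Ox) (OM Oy) xy.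
Qed.

Lemma step_sin (l : QP) : zero_below (- n) l -> step (fun x => sin (theta R l x)).
Proof.
by move=> nl x y Ox Oy xy; have [] := theta_agree R nE nl (OM Ox) (OM Oy) xy.
Qed.

End Integration.

(** * Spectra *)

Lemma Re_sum (R : realType) (F : finType) (P : pred F) (f : F -> R[i]) :
  complex.Re (\sum_(g | P g) f g) = \sum_(g | P g) complex.Re (f g).
Proof. by apply: (big_morph (@complex.Re R)) => // -[? ?] [? ?]. Qed.

Lemma Im_sum (R : realType) (F : finType) (P : pred F) (f : F -> R[i]) :
  complex.Im (\sum_(g | P g) f g) = \sum_(g | P g) complex.Im (f g).
Proof. by apply: (big_morph (@complex.Im R)) => // -[? ?] [? ?]. Qed.

Lemma sum_complex (R : realType) (F : finType) (P : pred F) (f g : F -> R) :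
  \sum_(h | P h) Complex (f h) (g h) = Complex (\sum_(h | P h) f h) (\sum_(h | P h) g h).
Proof. by apply/eqP; rewrite eq_complex Re_sum Im_sum /= !eqxx. Qed.

Lemma E_conj (R : realType) q :
  E R (- q) = Complex (complex.Re (E R q)) (- complex.Im (E R q)).
Proof. by rewrite /E rmorphN mulrN cosN sinN. Qed.

Section Spectrum.
Variables (R : realType) (p : nat).
Hypothesis hp : prime p.
Let p_gt0 : (0 < p)%N := prime_gt0 hp.
Let p_gt1 : (1 < p)%N := prime_gt1 hp.
Local Notation QP := (QP_ p_gt0).
Local Notation QPm := (QPm p_gt0).
Local Notation "0q" := (qp_zero p_gt0).
Local Notation E := (E R).
Variable m : {measure set QPm -> \bar R}.
Hypothesis Hm : haar_measure m.
Variables (I : set int) (Om : set QPm) (M n0 : int).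
Hypothesis tO : tree I Om.
Hypothesis OM : forall x, Om x -> zero_below M x.
Hypothesis On0 : forall x y, Om x -> agree n0 x y -> Om y.

Let oO : ord_in I Om. Proof. by case: tO. Qed.

Definition dual_orders : set int := [set j | I (- j - 1)].
Local Notation J := dual_orders.

Lemma order_ge i : I i -> M <= i.
Proof.
move=> Ii; have [[s Os] _ sat] := tO; rewrite leNgt; apply/negP => iM.
have [s' [Os' _]] := sat s i 1%N Os Ii p_gt1.
by rewrite (OM Os').
Qed.

(** Digits at positions from [n0] on can be changed without leaving [Om], so [Om] branches there. *)
Lemma order_level i : n0 <= i -> I i.
Proof.
move=> i0; apply: contrapT => nI; have [[s Os] _ _] := tO.
have [d dp ds] : exists2 d, (d < p)%N & d <> digit s i.
  by case: (digit s i) => [|k]; [exists 1%N|exists 0%N].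
pose s' : QP := MkQP p_gt0 (set_digit_valid s i dp).
have ss' : agree i s s' by move=> j ji /=; rewrite lt_eqF.
have Os' : Om s' by apply: On0 Os _; exact: agree_le ss'.
by have := oO Os Os' ss' nI; rewrite /= eqxx => /esym.
Qed.

Lemma dual_order_lt j : J j -> j < - M.
Proof. by move=> /order_ge; lia. Qed.

Lemma level_exists (k : int) : exists (n : int) (L : nat),
  [/\ n = M + L%:Z, n0 <= n & k <= n].
Proof.
pose n : int := Num.max M (Num.max n0 k).
by exists n, `|(n - M)%R|%N; rewrite /n; split; lia.
Qed.

Definition reps L (a : codes p M L I -> QP) :=
  forall g, [/\ Om (a g), zero_below M (a g) & dcode M L I (a g) = g].

Lemma reps_exist L : exists a, @reps L a.
Proof.
have [[s0 Os0] _ _] := tO.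
have ex (g : codes p M L I) := code_surj g tO Os0 (OM Os0).
by have [a aP] := choice ex; exists a.
Qed.

(** Reversing the window exchanges the positions in [J] with those in [I]. *)
Lemma card_dual_codes n L : n = M + L%:Z ->
  #|{: codes p (- n) L J}| = #|{: codes p M L I}|.
Proof.
move=> nE; rewrite !card_ffun card_ord; congr (p ^ _)%N.
rewrite !card_sig -!sum1_card (reindex_inj rev_ord_inj) /=; apply: eq_bigl => i.
rewrite !inE; apply: asbool_equiv_eq; rewrite /dual_orders /=.
have -> : - (- n + (L - i.+1)%N%:Z) - 1 = M + i%:Z by have := ltn_ord i; lia.
by [].
Qed.

Section Level.
Variables (n : int) (L : nat) (a : codes p M L I -> QP).
Hypotheses (nE : n = M + L%:Z) (n0n : n0 <= n) (aP : reps a).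

Let On x y : Om x -> agree n x y -> Om y.
Proof. by move=> Ox xy; apply: On0 Ox _; exact: agree_le xy. Qed.

Local Notation step := (step Om n).
Local Notation w l := ((W (- n) L l)%:R : rat).
Local Notation z x := ((W M L x)%:R : rat).
Local Notation q := ((p ^ L)%:R : rat).
Local Notation K := (#|{: codes p M L I}|%:R : R).
Local Notation pn := ((p%:R : R) ^ (- n)).

Lemma pn_gt0 : 0 < pn. Proof. by rewrite exprz_gt0 ?ltr0n. Qed.

Lemma K_gt0 : 0 < K.
Proof. by rewrite ltr0n; apply/card_gt0P; exists [ffun=> Ordinal p_gt0]. Qed.

Lemma theta_diff (l l' : QP) x : zero_below (- n) l -> zero_below (- n) l' -> Om x ->
  Complex (cos (theta R l x - theta R l' x)) (sin (theta R l x - theta R l' x)) =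
  E ((w l - w l') * z x / q).
Proof. by move=> nl nl' /OM Mx; rewrite (E_thetaB R nE) // -mulrBl. Qed.

Lemma theta_diffr (l : QP) x x' : zero_below (- n) l -> Om x -> Om x' ->
  Complex (cos (theta R l x - theta R l x')) (sin (theta R l x - theta R l x')) =
  E (w l * (z x - z x') / q).
Proof. by move=> nl /OM Mx /OM Mx'; rewrite (E_thetaB R nE) // -mulrBr. Qed.

Lemma character_integral (c : R) (l l' : QP) : zero_below (- n) l -> zero_below (- n) l' ->
  (\int[m]_(x in Om) (c * cos (theta R l x - theta R l' x))%:E)%E =
     (c * pn * complex.Re (\sum_g E ((w l - w l') * z (a g) / q)))%:E /\
  (\int[m]_(x in Om) (c * sin (theta R l x - theta R l' x))%:E)%E =
     (c * pn * complex.Im (\sum_g E ((w l - w l') * z (a g) / q)))%:E.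
Proof.
move=> nl nl'.
have st (x y : QPm) : Om x -> Om y -> agree n x y ->
   Complex (cos (theta R l x - theta R l' x)) (sin (theta R l x - theta R l' x)) =
   Complex (cos (theta R l y - theta R l' y)) (sin (theta R l y - theta R l' y)).
  by move=> Ox Oy xy; rewrite !theta_diff // (@W_agree _ _ _ _ x y) // -nE.
rewrite !(step_integral Hm nE oO OM On aP); last 2 first.
- by move=> x y Ox Oy /(st _ _ Ox Oy)[_ ->].
- by move=> x y Ox Oy /(st _ _ Ox Oy)[-> _].
rewrite Re_sum Im_sum !mulr_sumr; split; congr EFin; apply: eq_bigr => g _;
  by have [Og _ _] := aP g; rewrite -(theta_diff nl nl' Og) /= mulrAC.
Qed.

(** These are the real and imaginary parts of the inner product of [u + i v] with [chi_l]. Writing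
    the conjugate character as a difference from frequency 0 gives the shape of the exponential
    sums. *)
Lemma pairing_integral (u v : QPm -> R) (l : QP) : zero_below (- n) l -> step u -> step v ->
  let S := \sum_g Complex (u (a g)) (v (a g)) * E ((0 - w l) * z (a g) / q) in
  (\int[m]_(x in Om) (u x * cos (theta R l x) + v x * sin (theta R l x))%:E)%E =
     (pn * complex.Re S)%:E /\
  (\int[m]_(x in Om) (v x * cos (theta R l x) - u x * sin (theta R l x))%:E)%E =
     (pn * complex.Im S)%:E.
Proof.
move=> nl su sv S.
have sc := step_cos R nE OM nl; have ss := step_sin R nE OM nl.
rewrite !(step_integral Hm nE oO OM On aP); last 2 first.
- by move=> x y Ox Oy xy; rewrite (su x y) // (sv x y) // (sc x y) // (ss x y).
- by move=> x y Ox Oy xy; rewrite (su x y) // (sv x y) // (sc x y) // (ss x y).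
rewrite /S Re_sum Im_sum !mulr_sumr; split; congr EFin; apply: eq_bigr => g _;
  have [Og _ _] := aP g;
  rewrite sub0r !mulNr E_conj -/(char_value R M n L l (a g)) -(E_theta R nE nl (OM Og)) /=; ring.
Qed.

Lemma rep_level g g' : agree n (a g) (a g') -> g = g'.
Proof.
move=> gg'; have [_ _ <-] := aP g; have [_ _ <-] := aP g'.
by apply/codeP => j Mj jn Ij; apply: gg'; rewrite nE.
Qed.

Lemma fine_measure : fine (m Om) = K * pn.
Proof. by rewrite (Om_measure Hm nE oO OM On aP). Qed.

Lemma spectrum_sum (Lam : set QPm) (l l' : QP) : spectrum m Om Lam -> Lam l -> Lam l' ->
  zero_below (- n) l -> zero_below (- n) l' -> l <> l' -> \sum_g E ((w l - w l') * z (a g) / q) = 0.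
Proof.
move=> [orth _] Ll Ll' nl nl' ll'; have [h1 h2] := orth l l' Ll Ll'.
have [c1 c2] := character_integral (fine (m Om))^-1 nl nl'.
have f0 : (fine (m Om))^-1 * pn != 0.
  by rewrite mulf_neq0 ?invr_neq0 ?fine_measure ?mulf_neq0 ?gt_eqF ?K_gt0 ?pn_gt0.
move: h1; rewrite c1 => -[]; rewrite ifF; last by apply/eqP.
move=> /eqP; rewrite mulf_eq0 (negbTE f0) /= => /eqP r0.
move: h2; rewrite c2 => -[] /eqP; rewrite mulf_eq0 (negbTE f0) /= => /eqP i0.
by move: r0 i0; case: (\sum_g _) => ? ? /= -> ->.
Qed.

End Level.

Lemma spectrum_ord (Lam : set QPm) : spectrum m Om Lam -> ord_in J Lam.
Proof.
move=> sp l l' k Ll Ll' ll' nJ; apply: contrapT => dk; apply: nJ.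
have ne : l <> l' by move=> e; rewrite e in dk.
have [N [Nl Nl']] := zero_below2 l l'.
have [n [L [nE n0n kn]]] := level_exists (- N).
have [a aP] := reps_exist L.
have nl : zero_below (- n) l by apply: zero_below_le Nl; lia.
have nl' : zero_below (- n) l' by apply: zero_below_le Nl'; lia.
have S0 := spectrum_sum nE n0n aP sp Ll Ll' nl nl' ne.
have kn' : - n <= k by rewrite leNgt; apply/negP => lt; apply: dk; rewrite nl ?nl'.
(* If [k >= - M], both frequencies have the same residue and the sum would be the nonzero number of
   codes. *)
have [kM|Mk] := ltP k (- M); last first.
  have WE : W (- n) L l = W (- n) L l'.
    by apply: W_agree; apply: agree_le ll'; lia.
  move: S0; rewrite WE (eq_bigr (fun=> 1)); last by move=> g _; rewrite subrr !mul0r E0.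
  rewrite sumr_const => /eqP; rewrite pnatr_eq0 => /eqP K0.
  by have := K_gt0 L; rewrite ltr0n (eq_card (B := xpredT)) ?K0 // => ?; rewrite !inE.
have kE : k = - n + `|(k + n)%R|%N%:Z by lia.
have iL : (`|(k + n)%R| < L)%N by lia.
rewrite kE in ll' dk.
have [s [s' [Os Os' ss' ds]]] := tree_exp_sum_conv aP nl nl' ll' dk iL S0.
rewrite /dual_orders /=; apply: contrapT => nI; apply: ds; apply: (oO Os Os' ss').
by have -> : M + (L - `|(k + n)%R|.+1)%N%:Z = - k - 1 by lia.
Qed.

Lemma dual_ord_eq (Lam : set QPm) (l l' : QP) : ord_in J Lam -> Lam l -> Lam l' ->
  agree (- M) l l' -> l = l'.
Proof.
move=> oL Ll Ll' ll'; apply: agree_eq => k; apply: (ord_in_agree oL) => // j _ Jj.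
by apply: ll'; exact: dual_order_lt.
Qed.

(** The indicator of a ball minus its projection to the characters with frequency in [p^{-n} Z_p]
    turns out orthogonal to all of [Lam]. Completeness makes it vanish, and its value on the ball
    gives as many frequencies as codes. *)
Lemma spectrum_codes (Lam : set QPm) (n : int) (L : nat) (h0 : codes p (- n) L J) :
  n = M + L%:Z -> n0 <= n -> spectrum m Om Lam ->
  exists l, [/\ Lam l, zero_below (- n) l & dcode (- n) L J l = h0].
Proof.
move=> nE n0n sp; have oL := spectrum_ord sp.
have [a aP] := reps_exist L.
have On x y : Om x -> agree n x y -> Om y.
  by move=> Ox xy; apply: On0 Ox _; exact: agree_le xy.
pose X (h : codes p (- n) L J) :=
  `[< exists l, [/\ Lam l, zero_below (- n) l & dcode (- n) L J l = h] >].
have lex h : exists l : QP, X h -> [/\ Lam l, zero_below (- n) l & dcode (- n) L J l = h].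
  have [/asboolP[l lP]|nX] := boolP (X h); first by exists l.
  by exists 0q.
have [l lP] := choice lex.
pose K : R := #|{: codes p M L I}|%:R.
have K0 : 0 < K := K_gt0 L.
pose g0 : codes p M L I := [ffun=> Ordinal p_gt0].
pose c := a g0; have [Oc Mc _] := aP g0; rewrite -/c in Oc Mc.
pose B : set QPm := qp_ball c n.
have Bagree x : B x <-> agree n x c by rewrite /B (qp_ballE p_gt1).
have BO x : B x -> Om x by move=> /Bagree xc; apply: On Oc _; exact: agree_sym.
(* [u + i v] is the indicator of [B] minus its projection; the factor [K^-1] is the ratio of the
   measures of [B] and [Om]. *)
pose u (x : QPm) : R := \1_B x - K^-1 * \sum_(h | X h) cos (theta R (l h) x - theta R (l h) c).
pose v (x : QPm) : R := - (K^-1 * \sum_(h | X h) sin (theta R (l h) x - theta R (l h) c)).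
have indB x y : agree n x y -> \1_B x = \1_B y :> R by exact: indic_ball_agree.
have st x y h : Om x -> Om y -> agree n x y -> X h ->
    Complex (cos (theta R (l h) x - theta R (l h) c)) (sin (theta R (l h) x - theta R (l h) c)) =
    Complex (cos (theta R (l h) y - theta R (l h) c)) (sin (theta R (l h) y - theta R (l h) c)).
  move=> Ox Oy xy Xh; have [_ nl _] := lP h Xh.
  by rewrite !(theta_diffr nE) // (@W_agree _ _ _ _ x y) // -nE.
have su : step Om n u.
  move=> x y Ox Oy xy; rewrite /u (indB x y) //; congr (_ - _ * _).
  by apply: eq_bigr => h Xh; have [] := st x y h Ox Oy xy Xh.
have sv : step Om n v.
  move=> x y Ox Oy xy; rewrite /v; congr (- (_ * _)).
  by apply: eq_bigr => h Xh; have [] := st x y h Ox Oy xy Xh.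
have uvE g : Complex (u (a g)) (v (a g)) = ((g == g0)%:R)%:C%C - (K^-1)%:C%C *
    \sum_(h | X h)
      E ((W (- n) L (l h))%:R * ((W M L (a g))%:R - (W M L c)%:R) / (p ^ L)%:R).
  have [Og _ _] := aP g.
  have -> : \sum_(h | X h)
      E ((W (- n) L (l h))%:R * ((W M L (a g))%:R - (W M L c)%:R) / (p ^ L)%:R) =
      Complex (\sum_(h | X h) cos (theta R (l h) (a g) - theta R (l h) c))
              (\sum_(h | X h) sin (theta R (l h) (a g) - theta R (l h) c)).
    rewrite -sum_complex; apply: eq_bigr => h Xh; have [_ nl _] := lP h Xh.
    by rewrite (theta_diffr nE).
  have -> : (g == g0)%:R = \1_B (a g) :> R.
    rewrite indicE; congr (_%:R : R); congr nat_of_bool.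
    apply/eqP/idP => [->|/set_mem/Bagree/(rep_level nE aP)//].
    exact/mem_set/Bagree.
  by rewrite /u /v; apply/eqP; rewrite eq_complex /= !mul0r subr0 addr0 add0r !eqxx.
have Kinv : (K^-1)%:C%C * #|{: codes p M L I}|%:R = 1 :> R[i].
  by rewrite -(rmorph_nat (real_complex R)) -rmorphM /= mulVf ?rmorph1 // gt_eqF.
have orth (lam : QP) : Lam lam ->
    (\int[m]_(x in Om) (u x * cos (theta R lam x) + v x * sin (theta R lam x))%:E = 0)%E /\
    (\int[m]_(x in Om) (v x * cos (theta R lam x) - u x * sin (theta R lam x))%:E = 0)%E.
  (* For a frequency in the large ball, orthogonality leaves only the term of [lam] in the
     projection, which cancels the coefficient of the indicator. *)
  move=> Llam; have [nlam|nlam] := pselect (zero_below (- n) lam).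
    have [-> ->] := pairing_integral nE n0n aP nlam su sv.
    set S := \sum_g _; suff -> : S = 0 by rewrite /= mulr0.
    pose h1 := dcode (- n) L J lam.
    have Xh1 : X h1 by apply/asboolP; exists lam.
    have [Ll1 nl1 cl1] := lP h1 Xh1.
    have lamE : lam = l h1.
      apply: (dual_ord_eq oL) => //.
      have -> : - M = - n + L%:Z by lia.
      exact: (code_inj oL).
    pose wl : rat := (W (- n) L lam)%:R.
    pose zc : rat := (W M L c)%:R; pose q : rat := (p ^ L)%:R.
    have -> : S = E ((0 - wl) * zc / q) - (K^-1)%:C%C * \sum_(h | X h)
        (\sum_g E (((W (- n) L (l h))%:R - wl) * (W M L (a g))%:R / q)) *
        E ((0 - (W (- n) L (l h))%:R) * zc / q).
      rewrite /S; under eq_bigr do rewrite uvE mulrBl.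
      rewrite sumrB; congr (_ - _).
        rewrite (bigD1 g0) //= eqxx mul1r big1 ?addr0 // => g gg0.
        by rewrite (negbTE gg0) mul0r.
      rewrite mulr_sumr; under [RHS]eq_bigr do rewrite mulr_suml mulr_sumr.
      rewrite [RHS]exchange_big /=; apply: eq_bigr => g _.
      rewrite mulr_sumr mulr_suml; apply: eq_bigr => h _.
      rewrite -[LHS]mulrA -[in LHS]E_add -[in RHS]E_add; congr (_ * E _).
      rewrite /wl /zc /q; ring.
    rewrite (bigD1 h1) //= [Z in _ * (_ + Z)]big1 ?addr0; last first.
      move=> h /andP[Xh hh1]; have [Ll nl cl] := lP h Xh.
      rewrite (spectrum_sum nE n0n aP sp Ll Llam nl nlam) ?mul0r // => e.
      by move/eqP: hh1; apply; rewrite -cl e.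
    rewrite -lamE (eq_bigr (fun=> 1)); last by move=> g _; rewrite subrr !mul0r E0.
    rewrite sumr_const mulrA (eq_card (B := {: codes p M L I})) // Kinv mul1r.
    exact: subrr.
  (* Otherwise [lam] has its first nonzero digit at some [k < - n]. Then [- k - 1 >= n >= n0] is an
     order of [Om], while [u] and [v] only read digits below [n], so the weighted sum vanishes. *)
  have [N Nlam] := zero_below_exists lam.
  have [n' [L' [nE' n0n' kn']]] := level_exists (Num.max (- N) n).
  have [a' aP'] := reps_exist L'.
  have nlam' : zero_below (- n') lam by apply: zero_below_le Nlam; lia.
  have nn' : n <= n' by lia.
  have su' : step Om n' u by move=> x y Ox Oy xy; apply: su => //; exact: agree_le xy.
  have sv' : step Om n' v by move=> x y Ox Oy xy; apply: sv => //; exact: agree_le xy.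
  have [-> ->] := pairing_integral nE' n0n' aP' nlam' su' sv'.
  set S := \sum_g _; suff -> : S = 0 by rewrite /= mulr0.
  have lam0 : 0q <> lam by move=> e; apply: nlam; rewrite -e.
  have [k [klam dk]] := first_difference lam0.
  have kn : k < - n.
    rewrite ltNge; apply/negP => nk; apply: nlam => j jn.
    by rewrite -klam //; exact: lt_le_trans nk.
  have kn2 : - n' <= k by rewrite leNgt; apply/negP => lt; apply: dk; rewrite nlam'.
  have kE : k = - n' + `|(k + n')%R|%N%:Z by lia.
  have iL : (`|(k + n')%R| < L')%N by lia.
  have posE : M + (L' - `|(k + n')%R|.+1)%N%:Z = - k - 1 by lia.
  have W0q : (W (- n') L' 0q)%:R = 0 :> rat by rewrite W_zero_below.
  rewrite /S -W0q; rewrite kE in klam dk.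
  apply: (tree_weighted_exp_sum (S := Om)
    (c := fun g => Complex (u (a' g)) (v (a' g))) oO aP' _ _ nlam' klam dk iL) => //.
    move=> g g'; rewrite posE => gg'; have [Og _ _] := aP' g; have [Og' _ _] := aP' g'.
    by rewrite (su (a' g) (a' g')) ?(sv (a' g) (a' g')) //; apply: agree_le gg'; lia.
  by rewrite posE; apply: order_level; lia.
have su2 : step Om n (fun x => u x ^+ 2) by move=> x y Ox Oy xy; rewrite (su x y).
have sv2 : step Om n (fun x => v x ^+ 2) by move=> x y Ox Oy xy; rewrite (sv x y).
have [_ compl] := sp.
have /(ae_ball Hm c n)[x [xc]] := compl u v (step_measurable nE oO OM aP su)
  (step_measurable nE oO OM aP sv) (step_integrable Hm nE oO OM On aP su2)
  (step_integrable Hm nE oO OM On aP sv2) orth.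
have Ox : Om x by apply/BO/Bagree.
move=> /(_ Ox)[]; rewrite (su x c) // /u indicE mem_set; last exact/Bagree.
(* At the centre every cosine is 1, so [u c = 0] says that the number of occurring codes equals
   [K]. *)
rewrite (eq_bigr (fun=> 1)); last by move=> h _; rewrite subrr cos0.
rewrite sumr_const => /eqP; rewrite subr_eq0 => /eqP/(congr1 (fun t => K * t)).
rewrite mulr1 mulVKf ?gt_eqF // => /eqP; rewrite eqr_nat -(card_dual_codes nE) => /eqP XK _.
have XT : X =i predT.
  apply/(subset_cardP _); last exact: subset_predT.
  by rewrite -XK; apply: eq_card.
by have := XT h0; rewrite !inE => /asboolP.
Qed.

Lemma spectrum_tree (Lam : set QPm) : spectrum m Om Lam -> tree J Lam.
Proof.
move=> sp; pose N0 : int := - Num.max M n0.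
apply: (@tree_of_codes _ _ J Lam (- M) N0 dual_order_lt (spectrum_ord sp)) => N NN0 g.
have nE : - N = M + `|(- M - N)%R|%N%:Z by rewrite /N0 in NN0; lia.
have n0N : n0 <= - N by rewrite /N0 in NN0; lia.
have H h := @spectrum_codes Lam (- N) _ h nE n0N sp.
by rewrite opprK in H; exact: H.
Qed.

(** * Trees with the dual orders are spectra *)

Section TreeIsSpectrum.
Variable Lam : set QPm.
Hypothesis tL : tree J Lam.

Let oL : ord_in J Lam. Proof. by case: tL. Qed.

Lemma tree_orthonormal (l l' : QP) : Lam l -> Lam l' ->
  (\int[m]_(x in Om) ((fine (m Om))^-1 * cos (theta R l x - theta R l' x))%:E
     = (if l == l' then 1 else 0)%:E)%E /\
  (\int[m]_(x in Om) ((fine (m Om))^-1 * sin (theta R l x - theta R l' x))%:E = 0)%E.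
Proof.
move=> Ll Ll'; have [N [Nl Nl']] := zero_below2 l l'.
have [n [L [nE n0n kn]]] := level_exists (- N).
have [a aP] := reps_exist L.
have nl : zero_below (- n) l by apply: zero_below_le Nl; lia.
have nl' : zero_below (- n) l' by apply: zero_below_le Nl'; lia.
have [-> ->] := character_integral nE n0n aP (fine (m Om))^-1 nl nl'.
have [<-|/eqP ne] := eqVneq l l'.
  rewrite (eq_bigr (fun=> 1)); last by move=> g _; rewrite subrr !mul0r E0.
  rewrite sumr_const (eq_card (B := {: codes p M L I})) //.
  rewrite -(rmorph_nat (real_complex R)) /= mulr0; split=> //; congr EFin.
  rewrite (fine_measure nE n0n aP) -mulrA [X in _ * X]mulrC mulVf //.
  by rewrite mulf_neq0 // gt_eqF ?pn_gt0 ?K_gt0.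
have [k [ll' dk]] := first_difference ne.
have Jk : J k by apply: contrapT => nJ; apply: dk; exact: oL ll' nJ.
have kM := dual_order_lt Jk.
have kn' : - n <= k by rewrite leNgt; apply/negP => lt; apply: dk; rewrite nl ?nl'.
have kE : k = - n + `|(k + n)%R|%N%:Z by lia.
have iL : (`|(k + n)%R| < L)%N by lia.
rewrite kE in ll' dk.
rewrite (tree_exp_sum R oO aP nl nl' ll' dk iL) /= ?mulr0 //.
by have -> : M + (L - `|(k + n)%R|.+1)%N%:Z = - k - 1 by lia.
Qed.

Lemma dual_reps_exist n L : (exists2 s0, Lam s0 & zero_below (- n) s0) ->
  exists l : codes p (- n) L J -> QP,
  forall h, [/\ Lam (l h), zero_below (- n) (l h) & dcode (- n) L J (l h) = h].
Proof.
move=> [s0 Ls0 ns0]; have ex (h : codes p (- n) L J) := code_surj h tL Ls0 ns0.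
by have [l lP] := choice ex; exists l.
Qed.

(* The vanishing sums of [tree_orthonormal] with the roles of [Om] and [Lam] exchanged. *)
Lemma dual_orthogonality n L (l : codes p (- n) L J -> QP) (c x : QP) :
  n = M + L%:Z -> (forall h, [/\ Lam (l h), zero_below (- n) (l h) & dcode (- n) L J (l h) = h]) ->
  Om c -> Om x ->
  \sum_h cos (theta R (l h) c - theta R (l h) x) =
    #|{: codes p M L I}|%:R * \1_(qp_ball c n : set QPm) x /\
  \sum_h sin (theta R (l h) c - theta R (l h) x) = 0.
Proof.
move=> nE lP Oc Ox.
suff : \sum_h E (((W M L c)%:R - (W M L x)%:R) * (W (- n) L (l h))%:R / (p ^ L)%:R) =
   Complex (#|{: codes p M L I}|%:R * \1_(qp_ball c n : set QPm) x) 0.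
  have -> : \sum_h E (((W M L c)%:R - (W M L x)%:R) * (W (- n) L (l h))%:R / (p ^ L)%:R) =
    Complex (\sum_h cos (theta R (l h) c - theta R (l h) x))
            (\sum_h sin (theta R (l h) c - theta R (l h) x)).
    rewrite -sum_complex; apply: eq_bigr => h _; have [_ nl _] := lP h.
    by rewrite (theta_diffr nE) // [_ * (_ - _)]mulrC.
  by case.
have [xc|xc] := pselect (agree n c x).
  rewrite (W_agree (_ : agree (M + L%:Z) c x)) -?nE //.
  rewrite (eq_bigr (fun=> 1)); last by move=> h _; rewrite subrr !mul0r E0.
  rewrite sumr_const (eq_card (B := {: codes p (- n) L J})) // (card_dual_codes nE).
  rewrite -(rmorph_nat (real_complex R)) indicE mem_set ?mulr1 //.
  by rewrite (qp_ballE p_gt1); exact: agree_sym.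
have ne : c <> x by move=> e; apply: xc; rewrite e.
have [k [cx dk]] := first_difference ne.
have Ik : I k by apply: contrapT => nI; apply: dk; exact: oO cx nI.
have Mk := order_ge Ik.
have kn : k < n by rewrite ltNge; apply/negP => nk; apply: xc; exact: agree_le cx.
have kE : k = M + `|(k - M)%R|%N%:Z by lia.
have iL : (`|(k - M)%R| < L)%N by lia.
rewrite kE in cx dk.
rewrite (tree_exp_sum R oL lP (OM Oc) (OM Ox) cx dk iL); last first.
  rewrite /dual_orders /=.
  by have -> : - (- n + (L - `|(k - M)%R|.+1)%N%:Z) - 1 = k by lia.
rewrite indicE memNset ?mulr0 // (qp_ballE p_gt1) /= => xc'.
by apply: xc; exact: agree_sym.
Qed.

Lemma integral_lincomb0 (F : finType) (al be : F -> R) (f g : F -> QPm -> R) :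
  measurable Om ->
  (forall h, m.-integrable Om (EFin \o f h)) -> (forall h, m.-integrable Om (EFin \o g h)) ->
  (forall h, \int[m]_(x in Om) (f h x)%:E = 0)%E ->
  (forall h, \int[m]_(x in Om) (g h x)%:E = 0)%E ->
  (\int[m]_(x in Om) (\sum_h (al h * f h x + be h * g h x))%:E = 0)%E.
Proof.
move=> mO fi gi f0 g0.
have -> : (\int[m]_(x in Om) (\sum_h (al h * f h x + be h * g h x))%:E =
  \int[m]_(x in Om) (\sum_(h <- index_enum F | true)
    ((al h)%:E * (f h x)%:E + (be h)%:E * (g h x)%:E)))%E.
  by apply: eq_integral => x _; rewrite -sumEFin; apply: eq_bigr => h _; rewrite EFinD !EFinM.
have afi h : m.-integrable Om (fun x => (al h)%:E * (f h x)%:E)%E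
  by exact: (integrableZl mO (al h) (fi h)).
have bgi h : m.-integrable Om (fun x => (be h)%:E * (g h x)%:E)%E
  by exact: (integrableZl mO (be h) (gi h)).
rewrite integral_sum //; last by move=> h; exact: integrableD.
rewrite big1 // => h _; rewrite integralD //.
by rewrite (integralZl mO (fi h)) (integralZl mO (gi h)) f0 g0 !mule0 adde0.
Qed.

Lemma integrable_step_mul (mO : measurable Om) (f h : QPm -> R) (n : int) (L : nat)
    (a : codes p M L I -> QP) : n = M + L%:Z -> n0 <= n -> reps a ->
  m.-integrable Om (EFin \o f) -> step Om n h ->
  m.-integrable Om (EFin \o (fun x => f x * h x)).
Proof.
move=> nE n0n aP fi sh.
have := integrableMl mO fi (step_measurable nE oO OM aP sh) (step_bounded nE oO OM aP sh).
by congr (m.-integrable Om _); apply/funext => x /=; rewrite EFinM.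
Qed.

(** A Dynkin argument: balls are nested or disjoint, so with the empty set they form a generator
    stable under intersection. Any ball is reached from the hypothesis, since its indicator is a
    step function on [Om] at a finer level. *)
Lemma ae_zero_of_balls (mO : measurable Om) (f : QPm -> R) (k0 : int) :
  m.-integrable Om (EFin \o f) ->
  (forall n (L : nat) (a : codes p M L I -> QP) g, n = M + L%:Z -> n0 <= n -> k0 <= n ->
    reps a -> (\int[m]_(x in Om) (f x * \1_(qp_ball (a g) n : set QPm) x)%:E = 0)%E) ->
  {ae m, forall x, Om x -> f x = 0}.
Proof.
move=> fi fb.
have mf : measurable_fun Om (EFin \o f) := measurable_int m fi.
pose G : set (set QPm) := @qp_balls p p_gt0 `|` [set set0].
have ball0 (y : QP) (k : int) : (\int[m]_(x in Om `&` (qp_ball y k : set QPm)) (f x)%:E = 0)%E.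
  pose S : set QPm := qp_ball y k.
  have [n [L [nE n0n kn]]] := level_exists (Num.max k k0); have [a aP] := reps_exist L.
  have kn1 : k <= n by lia.
  have kn2 : k0 <= n by lia.
  have sS : step Om n (\1_S : QPm -> R).
    by move=> x x' _ _ xx'; apply: indic_ball_agree; exact: agree_le xx'.
  have sB g : step Om n (\1_(qp_ball (a g) n : set QPm) : QPm -> R).
    by move=> x x' _ _; exact: indic_ball_agree.
  have fBi g := integrable_step_mul mO nE n0n aP fi (sB g).
  have fB0 g := fb n L a g nE n0n kn2 aP.
  rewrite integral_mkcondr.
  rewrite -[RHS](integral_lincomb0 (fun g => \1_S (a g)) (fun=> 0) mO fBi fBi fB0 fB0).
  apply: eq_integral => x /set_mem Ox.
  transitivity ((f x * \1_S x)%:E).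
    by rewrite patchE indicE; case: ifP => _ /=; rewrite ?mulr1 ?mulr0.
  congr EFin; rewrite (step_sum nE oO OM aP sS Ox) mulr_sumr.
  by apply: eq_bigr => g _; rewrite mul0r addr0 mulrCA.
have GE : @measurable _ QPm = <<s G >>.
  apply/seteqP; split; first by apply: sub_sigma_algebra2 => A; left.
  apply: smallest_sub; first exact: sigma_algebra_measurable.
  by move=> A [|->]; [exact: sub_sigma_algebra|exact: measurable0].
have GI : setI_closed G.
  move=> A B [[x [i ->]]|->]; last by rewrite set0I; right.
  move=> [[y [j ->]]|->]; last by rewrite setI0; right.
  have [e|/set0P[z [zx zy]]] := eqVneq (qp_ball x i `&` qp_ball y j) set0.
    by rewrite e; right.
  left; exists z, (Num.max i j); move: zx zy; rewrite !(qp_ballE p_gt1) /= => zx zy.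
  apply/seteqP; split=> t /= => [[tx ty]|tz].
    have [ij|ji] := leP i j.
      exact: agree_trans ty (agree_sym zy).
    exact: agree_trans tx (agree_sym zx).
  split; [apply: agree_trans zx|apply: agree_trans zy]; apply: agree_le tz; lia.
have all0 (S : set QPm) : measurable S -> (\int[m]_(x in Om `&` S) (f x)%:E = 0)%E.
  rewrite {1}GE; move: S.
  apply: (@dynkin_induction _ QPm G (fun S => \int[m]_(x in Om `&` S) (f x)%:E = 0)%E GE GI).
  (* The whole space is covered by a ball, because [Om] lies in [p^M Z_p]. *)
  - rewrite setIT; have -> : Om = Om `&` (qp_ball 0q M : set QPm); last exact: ball0.
    apply/seteqP; split=> [x Ox|x []//]; split=> //; rewrite (qp_ballE p_gt1) /=.
    by apply: zero_below_agree => //; exact: OM.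
  - by move=> A [[x [i ->]]|->]; [exact: ball0|rewrite setI0 integral_set0].
  - move=> S mS S0.
    have T0 : (\int[m]_(x in Om) (f x)%:E = 0)%E.
      have -> : Om = Om `&` (qp_ball 0q M : set QPm); last exact: ball0.
      apply/seteqP; split=> [x Ox|x []//]; split=> //; rewrite (qp_ballE p_gt1) /=.
      by apply: zero_below_agree => //; exact: OM.
    have OE : Om = (Om `&` S) `|` (Om `&` ~` S) by rewrite -setIUr setUv setIT.
    move: T0; rewrite {1}OE integral_setU.
    + by rewrite S0 add0e.
    + exact: measurableI.
    + by apply: measurableI => //; exact: measurableC.
    + by rewrite -OE.
    + by apply/disj_setPS => x [[_ Sx] [_ nSx]].
  - move=> F mF tF F0; rewrite setI_bigcupr integral_bigcup.
    + by apply: eseries0 => i _ _; exact: F0.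
    + exact: trivIset_setIl.
    + by move=> i; exact: measurableI.
    + apply: integrableS fi => //; last by move=> x [i _ []].
      by apply: bigcupT_measurable => i; exact: measurableI.
have := @integral_ae_eq _ _ _ m Om mO (cst 0%E) _ fi (measurable_cst _).
have h (E : set QPm) : E `<=` Om -> measurable E ->
    (\int[m]_(x in E) (EFin \o f) x = \int[m]_(x in E) cst 0 x)%E.
  move=> EO mE; rewrite integral0; have -> : E = Om `&` E by rewrite setIidr.
  exact: all0.
by move=> /(_ h); apply: filterS => x fx Ox; have [] := fx Ox.
Qed.

(** By [dual_orthogonality] the indicator of a small ball is, on [Om], a finite combination of
    characters from [Lam]; hence [u] and [v] integrate to 0 over such balls. *)
Lemma tree_complete (u v : QPm -> R) :
  measurable_fun Om u -> measurable_fun Om v ->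
  m.-integrable Om (fun x => (u x ^+ 2)%:E) ->
  m.-integrable Om (fun x => (v x ^+ 2)%:E) ->
  (forall l, Lam l ->
     (\int[m]_(x in Om) (u x * cos (theta R l x) + v x * sin (theta R l x))%:E = 0)%E
     /\ (\int[m]_(x in Om) (v x * cos (theta R l x) - u x * sin (theta R l x))%:E = 0)%E) ->
  {ae m, forall x, Om x -> u x = 0 /\ v x = 0}.
Proof.
move=> mu mv iu2 iv2 orth.
have Onl (n : int) : n0 <= n -> forall x y, Om x -> agree n x y -> Om y.
  by move=> n0n x y Ox xy; apply: On0 Ox _; exact: agree_le xy.
have [n1 [L1 [nE1 n0n1 _]]] := level_exists 0; have [a1 aP1] := reps_exist L1.
have mO : measurable Om := Om_measurable nE1 oO OM (Onl _ n0n1) aP1.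
(* On a set of finite measure, [|f| <= 1 + f^2] makes square integrable functions integrable. *)
have L2L1 (f : QPm -> R) : measurable_fun Om f ->
    m.-integrable Om (fun x => (f x ^+ 2)%:E) -> m.-integrable Om (EFin \o f).
  move=> mf if2.
  have i1 : m.-integrable Om (EFin \o (fun=> 1 : R)).
    by apply: (step_integrable Hm nE1 oO OM (Onl _ n0n1) aP1).
  apply: (le_integrable mO _ _ (integrableD mO i1 if2)); first exact/measurable_EFinP.
  move=> x _ /=; rewrite lee_fin [leRHS]ger0_norm ?addr_ge0 ?sqr_ge0 // ler_norml.
  by apply/andP; split; nra.
have iu := L2L1 u mu iu2; have iv := L2L1 v mv iv2.
have iM := integrable_step_mul mO.
have [[s0 Ls0] _ _] := tL; have [N0 N0s0] := zero_below_exists s0.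
(* The bound [- N0 <= n] puts [s0] in [p^{-n} Z_p], from where every dual code is realized in
   [Lam]. *)
have ball0 n (L : nat) (a : codes p M L I -> QP) g : n = M + L%:Z -> n0 <= n -> - N0 <= n ->
    reps a ->
    (\int[m]_(x in Om) (u x * \1_(qp_ball (a g) n : set QPm) x)%:E = 0)%E /\
    (\int[m]_(x in Om) (v x * \1_(qp_ball (a g) n : set QPm) x)%:E = 0)%E.
  move=> nE n0n nN0 aP; have [Oc _ _] := aP g; set c := a g in Oc *.
  have [l lP] : exists l : codes p (- n) L J -> QP,
      forall h, [/\ Lam (l h), zero_below (- n) (l h) & dcode (- n) L J (l h) = h].
    by apply: dual_reps_exist; exists s0 => //; apply: zero_below_le N0s0; lia.
  pose f h (x : QPm) := u x * cos (theta R (l h) x) + v x * sin (theta R (l h) x).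
  pose k h (x : QPm) := v x * cos (theta R (l h) x) - u x * sin (theta R (l h) x).
  have sc h : step Om n (fun x => cos (theta R (l h) x)).
    by have [_ nl _] := lP h; exact: (step_cos R nE OM nl).
  have ss h : step Om n (fun x => sin (theta R (l h) x)).
    by have [_ nl _] := lP h; exact: (step_sin R nE OM nl).
  have fi h : m.-integrable Om (EFin \o f h).
    have := integrableD mO (iM _ _ _ _ _ nE n0n aP iu (sc h)) (iM _ _ _ _ _ nE n0n aP iv (ss h)).
    by congr (m.-integrable Om _); apply/funext => x /=; rewrite EFinD.
  have ki h : m.-integrable Om (EFin \o k h).
    have := integrableB mO (iM _ _ _ _ _ nE n0n aP iv (sc h)) (iM _ _ _ _ _ nE n0n aP iu (ss h)).
    by congr (m.-integrable Om _); apply/funext => x /=; rewrite EFinB.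
  have f0 h : (\int[m]_(x in Om) (f h x)%:E = 0)%E.
    by have [Ll _ _] := lP h; have [] := orth _ Ll.
  have k0 h : (\int[m]_(x in Om) (k h x)%:E = 0)%E.
    by have [Ll _ _] := lP h; have [] := orth _ Ll.
  pose K : R := #|{: codes p M L I}|%:R.
  have K0 : K != 0 by rewrite gt_eqF // (K_gt0 L).
  have indE x : Om x -> \1_(qp_ball c n : set QPm) x =
      K^-1 * \sum_h cos (theta R (l h) c - theta R (l h) x).
    by move=> Ox; have [-> _] := dual_orthogonality nE lP Oc Ox; rewrite mulKf.
  have sin0E x : Om x -> K^-1 * \sum_h sin (theta R (l h) c - theta R (l h) x) = 0.
    by move=> Ox; have [_ ->] := dual_orthogonality nE lP Oc Ox; rewrite mulr0.
  split.
    rewrite -[RHS](integral_lincomb0 (fun h => K^-1 * cos (theta R (l h) c))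
      (fun h => - (K^-1 * sin (theta R (l h) c))) mO fi ki f0 k0).
    apply: eq_integral => x /set_mem Ox; congr EFin.
    transitivity (u x * (K^-1 * \sum_h cos (theta R (l h) c - theta R (l h) x)) -
                  v x * (K^-1 * \sum_h sin (theta R (l h) c - theta R (l h) x))).
      by rewrite sin0E // mulr0 subr0 indE.
    rewrite !mulr_sumr -sumrB.
    by apply: eq_bigr => h _; rewrite cosB sinB /f /k; ring.
  rewrite -[RHS](integral_lincomb0 (fun h => K^-1 * sin (theta R (l h) c))
      (fun h => K^-1 * cos (theta R (l h) c)) mO fi ki f0 k0).
  apply: eq_integral => x /set_mem Ox; congr EFin.
  transitivity (v x * (K^-1 * \sum_h cos (theta R (l h) c - theta R (l h) x)) +
                u x * (K^-1 * \sum_h sin (theta R (l h) c - theta R (l h) x))).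
    by rewrite sin0E // mulr0 addr0 indE.
  rewrite !mulr_sumr -big_split.
  by apply: eq_bigr => h _; rewrite /= cosB sinB /f /k; ring.
have au : {ae m, forall x, Om x -> u x = 0}.
  by apply: (ae_zero_of_balls mO iu (k0 := - N0)) => n L a g nE n0n nN aP;
    have [] := ball0 n L a g nE n0n nN aP.
have av : {ae m, forall x, Om x -> v x = 0}.
  by apply: (ae_zero_of_balls mO iv (k0 := - N0)) => n L a g nE n0n nN aP;
    have [] := ball0 n L a g nE n0n nN aP.
by apply: filterS2 au av => x ux vx Ox; split; [exact: ux|exact: vx].
Qed.

Lemma tree_spectrum : spectrum m Om Lam.
Proof. by split=> [l l'|u v]; [exact: tree_orthonormal|exact: tree_complete]. Qed.

End TreeIsSpectrum.

Lemma spectrumP (Lam : set QPm) : spectrum m Om Lam <-> tree J Lam.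
Proof. by split; [exact: spectrum_tree|exact: tree_spectrum]. Qed.

End Spectrum.

(** * Tilings *)

Section Translation.
Variables (p : nat) (p_gt0 : (0 < p)%N).
Local Notation QP := (QP_ p_gt0).
Implicit Types (x y t : QP).

Lemma qp_addC x y : qp_add x y = qp_add y x.
Proof.
have [N [Nx Ny]] := zero_below2 x y; apply: agree_eq => n.
have [nN|Nn] := leP n N; first by apply: agree_le nN _; apply: zero_below_agree; exact: zero_below_add.
have -> : n = N + `|(n - N)%R|%N%:Z by lia.
apply: W_inj; [exact: zero_below_add|exact: zero_below_add|].
set k := `|_|%N; rewrite -(modn_small (W_lt N k (qp_add x y))) W_add // addnC.
by rewrite -W_add // modn_small ?W_lt.
Qed.

Lemma qp_addK x y : qp_sub (qp_add x y) y = x.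
Proof. by apply: agree_eq => n; apply/agree_sub. Qed.

Lemma agree_addr n x y t : agree n (qp_add x t) (qp_add y t) <-> agree n x y.
Proof. by rewrite -agree_sub qp_addK. Qed.

Lemma agree_subr n x t t' : agree n (qp_sub x t) (qp_sub x t') <-> agree n t t'.
Proof.
rewrite agree_sub; have := agree_addr n t' t (qp_sub x t').
rewrite ![qp_add _ (qp_sub x t')]qp_addC qp_subK => ->.
by split; exact: agree_sym.
Qed.

End Translation.

(** Take [k = - d' / d] modulo [p ^ L]; it is prime to [p] because [d'] is. This multiplier produces
    the collision in [exact_tiling_ord]. *)
Lemma unit_solution (p L : nat) (d d' : int) : prime p -> ~~ (p %| d)%Z -> ~~ (p %| d')%Z ->
  exists k : nat, [/\ (0 < k)%N, coprime k p & ((p ^ L)%N%:Z %| k%:Z * d + d')%Z].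
Proof.
move=> hp pd pd'; have [L0|L0] := posnP L.
  by exists 1%N; rewrite L0 expn0 coprime1n dvd1z.
have : coprimez d (p ^ L)%N%:Z.
  by rewrite coprimezE /= coprime_sym coprime_pexpl // prime_coprime.
move=> /coprimezP[[u v] /= uv].
pose P : int := (p ^ L)%N%:Z.
have P0 : P != 0 by rewrite /P; have := prime_gt0 hp; have := expn_gt0 p L; lia.
pose k := ((- d' * u) %% P)%Z.
have k0 : 0 <= k by exact: modz_ge0.
have pP : (p%:Z %| P)%Z by rewrite dvdzE /= dvdn_exp.
have kd : (P %| k * d + d')%Z.
  have -> : k * d + d' = P * (d' * v - (- d' * u %/ P)%Z * d).
    have := divz_eq (- d' * u) P; rewrite -/k => e.
    have -> : k = - d' * u - (- d' * u %/ P)%Z * P by rewrite {1}e addrC addKr.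
    have e2 : v * P = 1 - u * d by rewrite -uv addrC addKr.
    set Q := (_ %/ P)%Z.
    have -> : P * (d' * v - Q * d) = d' * (v * P) - Q * P * d by ring.
    by rewrite e2; ring.
  exact: dvdz_mulr.
have pk : ~~ (p%:Z %| k)%Z.
  apply: contra pd' => pk; have := dvdz_trans pP kd.
  by rewrite rpredDl // dvdz_mulr.
exists `|k|%N; split.
- by rewrite absz_gt0; apply: contraNneq pk => ->; rewrite dvdz0.
- by rewrite coprime_sym prime_coprime // -[p]/(`|p%:Z|%N) -dvdzE.
- by rewrite gez0_abs.
Qed.

(** A point of [A] satisfying [P] splits off a term 1; a second such point would bring the sum to at
    least 2. *)
Lemma esum_indicator_eq1 (R : realType) (T : choiceType) (A : set T) (P : T -> bool) :
  (\esum_(t in A) ((P t)%:R : R)%:E = 1)%E <->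
  exists t, [/\ A t, P t & forall t', A t' -> P t' -> t' = t].
Proof.
have ge0 t : A t -> (0 <= ((P t)%:R : R)%:E)%E by move=> _; rewrite lee_fin.
have split_at t : A t -> P t -> (\esum_(t in A) ((P t)%:R : R)%:E =
    1 + \esum_(t in A `&` ~` [set t]) ((P t)%:R : R)%:E)%E.
  move=> At Pt; rewrite (esumID [set t]) //; congr (_ + _)%E.
  have -> : A `&` [set t] = [set t] by apply/seteqP; split=> [s []//|s ->].
  by rewrite esum_set1 ?Pt // lee_fin.
split=> [e|[t [At Pt uni]]]; last first.
  rewrite (split_at t) // esum1 ?adde0 // => s [As st].
  by case: (boolP (P s)) => // Ps; case: st; exact: uni.
have [t [At Pt]] : exists t, A t /\ P t.
  apply: contrapT => nt; move: e; rewrite esum1 => [/eqP|t At].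
    by rewrite eqe eq_sym oner_eq0.
  by case: (boolP (P t)) => // Pt; case: nt; exists t.
exists t; split=> // s As Ps; apply: contrapT => st.
have : (1 + 1 <= 1 :> \bar R)%E.
  rewrite -[leRHS]e (split_at t) // leeD2l //; apply: esum_ge.
  exists [set s]; last by rewrite fsbig_set1 Ps.
  by split=> [|r ->]; [exact: finite_set1|split].
by rewrite -EFinD lee_fin; lra.
Qed.

Section Tiling.
Variables (R : realType) (p : nat).
Hypothesis hp : prime p.
Let p_gt0 : (0 < p)%N := prime_gt0 hp.
Let p_gt1 : (1 < p)%N := prime_gt1 hp.
Local Notation QP := (QP_ p_gt0).
Local Notation QPm := (QPm p_gt0).
Variable m : {measure set QPm -> \bar R}.
Hypothesis Hm : haar_measure m.
Variables (I : set int) (Om : set QPm) (M n0 : int).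
Hypothesis tO : tree I Om.
Hypothesis OM : forall x, Om x -> zero_below M x.
Hypothesis On0 : forall x y, Om x -> agree n0 x y -> Om y.

Let oO : ord_in I Om. Proof. by case: tO. Qed.

Definition exact_tiling (T : set QP) := forall x, exists t, [/\ T t, Om (qp_sub x t) &
  forall t', T t' -> Om (qp_sub x t') -> t' = t].

(** The tiling condition at [x] depends only on the digits of [x] below [n0], and every ball
    contains a point where it holds, so almost everywhere becomes everywhere. *)
Lemma tiling_complementP (T : set QPm) : tiling_complement m Om T <-> exact_tiling T.
Proof.
have pt (x : QPm) : (\esum_(t in T) (\1_Om (qp_sub x t) : R)%:E = 1)%E <->
    exists t, [/\ T t, Om (qp_sub x t) & forall t', T t' -> Om (qp_sub x t') -> t' = t].
  have -> : (\esum_(t in T) (\1_Om (qp_sub x t) : R)%:E =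
     \esum_(t in T) ((qp_sub x t \in Om)%:R : R)%:E)%E by apply: eq_esum => t _; rewrite indicE.
  rewrite esum_indicator_eq1; split=> -[t [Tt Ot uni]]; exists t; split=> //.
  - exact: set_mem.
  - by move=> t' Tt' Ot'; apply: uni => //; exact: mem_set.
  - exact: mem_set.
  - by move=> t' Tt' /set_mem; exact: uni.
split=> [h x|h]; last by apply: aeW => x; apply/pt.
have [y [yx /pt[t [Tt Ot uni]]]] := ae_ball Hm x n0 h.
have tr s : agree n0 (qp_sub y s) (qp_sub x s) by apply/agree_subl.
exists t; split=> //; first exact: On0 Ot (tr t).
by move=> t' Tt' Ot'; apply: uni => //; apply: On0 Ot' _; exact: agree_sym.
Qed.

(** Existence: [x = s + t] is approximated digit by digit, since at each position exactly one of the
    two trees branches and can correct the digit. Uniqueness: a first difference of [t] and [t']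
    would be an order of both trees. *)
Lemma tree_exact_tiling (T : set QP) : tree (~` I) T -> exact_tiling T.
Proof.
move=> [[t0 Tt0] oT sT] x; have [[s0 Os0] _ sO] := tO.
have [N1 [N1x N1t]] := zero_below2 x t0.
pose N : int := Num.min (Num.min N1 M) n0.
have Nx : zero_below N x by apply: zero_below_le N1x; rewrite /N; lia.
have Nt : zero_below N t0 by apply: zero_below_le N1t; rewrite /N; lia.
have Ns : zero_below N s0 by apply: zero_below_le (OM Os0); rewrite /N; lia.
have ind (k : nat) : exists s t, [/\ Om s, T t & agree (N + k%:Z) x (qp_add s t)].
  elim: k => [|k [s [t [Os Tt xst]]]].
    by exists s0, t0; split=> //; rewrite addr0; apply: zero_below_agree => //; exact: zero_below_add.
  have -> : N + k.+1%:Z = N + k%:Z + 1 by lia.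
  have [Ik|nIk] := pselect (I (N + k%:Z)).
    have [s' [Os' ss' ds']] := sO s _ _ Os Ik (digit_lt (qp_sub x t) (N + k%:Z)).
    exists s', t; split=> //; apply/agree_sub; apply: agreeS => //.
    by apply: agree_trans ss'; apply/agree_sub.
  have [t' [Tt' tt' dt']] := sT t _ _ Tt nIk (digit_lt (qp_sub x s) (N + k%:Z)).
  exists s, t'; split=> //; rewrite qp_addC; apply/agree_sub; apply: agreeS => //.
  by apply: agree_trans tt'; apply/agree_sub; rewrite qp_addC.
have [s [t [Os Tt xst]]] := ind `|(n0 - N)%R|%N.
have {}xst : agree n0 (qp_sub x t) s.
  by apply/agree_sub; have -> : n0 = N + `|(n0 - N)%R|%N%:Z by [rewrite /N; lia|exact: xst].
have Ot : Om (qp_sub x t) by apply: On0 Os _; exact: agree_sym.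
exists t; split=> // t' Tt' Ot'; apply: contrapT => ne.
have [k [tt' dk]] := first_difference ne.
have nIk : ~ I k by move=> Ik; apply: dk; apply: oT tt' _ => //; exact.
have : agree (k + 1) t' t.
  apply/(agree_subr _ x); apply: agreeS; first exact/agree_subr.
  by apply: oO => //; exact/agree_subr.
by move=> /(_ k) e; apply: dk; apply: e; lia.
Qed.

Section ExactIsTree.
Variable T : set QP.
Hypothesis eT : exact_tiling T.

Lemma exact_tiling_uniq (s s' t t' : QP) : Om s -> Om s' -> T t -> T t' ->
  agree n0 (qp_add s t) (qp_add s' t') -> t = t' /\ agree n0 s s'.
Proof.
move=> Os Os' Tt Tt' e; pose x := qp_add s t.
have [t1 [_ _ uni]] := eT x.
have tE : t = t1 by apply: uni => //; rewrite qp_addK.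
have tE' : t' = t1.
  by apply: uni => //; apply: On0 Os' _; apply: agree_sym; apply/agree_sub.
by rewrite {1}tE tE'; split=> //; move: e; rewrite tE tE' => /agree_addr.
Qed.

Section Window.
Variables (N : int) (L : nat) (a : codes p N L I -> QP).
Hypotheses (NM : N <= M) (LE : n0 = N + L%:Z).
Hypothesis aP : forall g, [/\ Om (a g), zero_below N (a g) & dcode N L I (a g) = g].

(** Residues replace codes on the side of [T], which is not yet known to be a tree. *)
Definition residues := {b : 'I_(p ^ L) | `[< exists t, [/\ T t, zero_below N t & W N L t = b] >]}.

Variable r : residues -> QP.
Hypothesis rP : forall b, [/\ T (r b), zero_below N (r b) & W N L (r b) = val b].

Lemma tiling_direct : direct_mod (p ^ L) (fun g => W N L (a g)) (fun b => W N L (r b)).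
Proof.
move=> g g' b b' e.
have [Og Ng cg] := aP g; have [Og' Ng' cg'] := aP g'.
have [Tb Nb Wb] := rP b; have [Tb' Nb' Wb'] := rP b'.
have ag : agree n0 (qp_add (a g) (r b)) (qp_add (a g') (r b')).
  rewrite LE; apply: W_inj; [exact: zero_below_add|exact: zero_below_add|].
  have := W_add L Ng Nb; have := W_add L Ng' Nb'.
  by rewrite -e => <-; rewrite !modn_small ?W_lt.
have [rb gg'] := exact_tiling_uniq Og Og' Tb Tb' ag.
split; last by apply/val_inj/val_inj; rewrite /= -Wb -Wb' rb.
rewrite -cg -cg'; apply/codeP => j _ jn _; apply: gg'; rewrite LE //.
Qed.

Lemma tiling_card : (#|{: codes p N L I}| * #|{: residues}| = p ^ L)%N.
Proof.
have pL : (0 < p ^ L)%N by rewrite expn_gt0 p_gt0.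
pose f (c : codes p N L I * residues) : 'I_(p ^ L) :=
  Ordinal (ltn_pmod (W N L (a c.1) + W N L (r c.2)) pL).
have finj : injective f.
  by move=> [g b] [g' b'] /(congr1 val) /= /tiling_direct[-> ->].
rewrite -card_prod -[RHS]card_ord; apply: (@bij_eq_card _ _ f).
(* Lift [z] to a point of [p^N Z_p] and decompose it by the tiling; both components lie in [p^N Z_p]
   as [N <= M]. *)
have surj z : exists c, f c = z.
  have [x [Nx Wx]] : exists x : QP, zero_below N x /\ forall k, W N k x = (z %% p ^ k)%N.
    apply: digit_of_residues => k; first by rewrite ltn_pmod ?expn_gt0 ?p_gt0.
    by rewrite modn_mod modn_dvdm // dvdn_exp2l.
  have [t [Tt Ot _]] := eT x; set s := qp_sub x t in Ot.
  have xE : qp_add s t = x by exact: qp_subK.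
  have Ns : zero_below N s by apply: zero_below_le (OM Ot).
  have Nt : zero_below N t by rewrite -(qp_addK t s) qp_addC xE; exact: zero_below_sub.
  have bP : `[< exists t', [/\ T t', zero_below N t' & W N L t' = Ordinal (W_lt N L t)] >].
    by apply/asboolP; exists t.
  exists (dcode N L I s, exist _ (Ordinal (W_lt N L t)) bP); apply: val_inj => /=.
  have [_ _ ->] := rP (exist _ (Ordinal (W_lt N L t)) bP); rewrite /=.
  have [Og Ng cg] := aP (dcode N L I s).
  have sg := code_inj oO Og Ot Ng Ns cg; rewrite (W_agree sg) -W_add // xE.
  by rewrite Wx modn_mod modn_small.
have [h hP] := choice surj.
by exists h => // c; apply: finj; rewrite hP.
Qed.

End Window.

Lemma residue_reps N L : exists r : residues N L -> QP,
  forall b, [/\ T (r b), zero_below N (r b) & W N L (r b) = val b].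
Proof.
have ex (b : residues N L) : exists t, [/\ T t, zero_below N t & W N L t = val b].
  by have /asboolP := valP b.
by have [r rP] := choice ex; exists r.
Qed.

Lemma Om_reps N L : N <= M -> exists a : codes p N L I -> QP,
  forall g, [/\ Om (a g), zero_below N (a g) & dcode N L I (a g) = g].
Proof.
move=> NM; have [[s0 Os0] _ _] := tO; have Ns0 : zero_below N s0 by exact: zero_below_le (OM Os0).
have ex (g : codes p N L I) := code_surj g tO Os0 Ns0.
by have [a aP] := choice ex; exists a.
Qed.

(** If [t] and [t'] first differ at some [k] in [I], so do some [s0] and [s1] in [Om]. A multiplier
    [q] prime to [p] makes the two differences cancel modulo [p ^ L], a collision excluded by
    Tijdeman's lemma. *)
Lemma exact_tiling_ord : ord_in (~` I) T.
Proof.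
move=> t t' k Tt Tt' tt' /contrapT Ik; apply: contrapT => dk.
have ne : t <> t' by move=> e; rewrite e in dk.
have [[s0 Os0] _ sO] := tO.
(* From level [n0] on, the translates of [Om] by [t] and [t'] would overlap. *)
have kn0 : k < n0.
  rewrite ltNge; apply/negP => n0k; apply: ne.
  have [] // := exact_tiling_uniq Os0 Os0 Tt Tt' _.
  by rewrite ![qp_add s0 _]qp_addC; apply/agree_addr; exact: agree_le tt'.
have Mk := order_ge tO OM Ik.
have [N1 [N1t N1t']] := zero_below2 t t'; pose N : int := Num.min N1 M.
have Nt : zero_below N t by apply: zero_below_le N1t; rewrite /N; lia.
have Nt' : zero_below N t' by apply: zero_below_le N1t'; rewrite /N; lia.
have NM : N <= M by rewrite /N; lia.
pose L := `|(n0 - N)%R|%N; have LE : n0 = N + L%:Z by rewrite /L; lia.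
have [a aP] := Om_reps L NM; have [r rP] := residue_reps N L.
have [d dp ds] : exists2 d, (d < p)%N & digit s0 k <> d.
  by case: (digit s0 k) => [|j]; [exists 1%N|exists 0%N].
have [s1 [Os1 s01 ds1]] := sO s0 k d Os0 Ik dp.
pose i := `|(k - N)%R|%N; have kE : k = N + i%:Z by rewrite /i; lia.
have iL : (i < L)%N by rewrite /i /L; lia.
pose g := dcode N L I s0; pose g' := dcode N L I s1.
have [Og Ng cg] := aP g; have [Og' Ng' cg'] := aP g'.
have s0g : agree n0 s0 (a g).
  by rewrite LE; apply: (code_inj oO) => //; exact: zero_below_le (OM _).
have s1g : agree n0 s1 (a g').
  by rewrite LE; apply: (code_inj oO) => //; exact: zero_below_le (OM _).
have gg' : agree k (a g) (a g').
  apply: agree_trans (agree_sym (agree_le (ltW kn0) s0g)) _.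
  exact: agree_trans s01 (agree_le (ltW kn0) s1g).
have dg : digit (a g) k <> digit (a g') k by rewrite -s0g // -s1g // ds1.
rewrite kE in gg' dg tt' dk.
have [e pe We] := W_diff Ng Ng' gg' dg iL.
have [e' pe' We'] := W_diff Nt Nt' tt' dk iL.
(* Both differences are [p ^ i] times units [e] and [e']; [q] solves [q e + e' = 0] modulo
   [p ^ L]. *)
have [q [q0 qp qe]] := unit_solution L hp pe pe'.
have pL : (0 < p ^ L)%N by rewrite expn_gt0 p_gt0.
have qpL : coprime q (p ^ L) by rewrite coprimeXr.
have := tijdeman pL (tiling_card NM LE aP rP) q0 qpL (tiling_direct LE aP rP).
have bP (u : QP) : T u -> zero_below N u ->
    `[< exists t, [/\ T t, zero_below N t & W N L t = Ordinal (W_lt N L u)] >].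
  by move=> Tu Nu; apply/asboolP; exists u.
pose b : residues N L := exist _ (Ordinal (W_lt N L t)) (bP t Tt Nt).
pose b' : residues N L := exist _ (Ordinal (W_lt N L t')) (bP t' Tt' Nt').
have [_ _ Wb] := rP b; have [_ _ Wb'] := rP b'; rewrite /= in Wb Wb'.
move=> /(_ g g' b b'); rewrite Wb Wb' => h.
have [] := h; last by move=> gE _; apply: dg; rewrite gE.
have WeZ : (W N L (a g))%:Z - (W N L (a g'))%:Z = (p ^ i)%N%:Z * e.
  by apply/eqP; rewrite -(eqr_int rat) rmorphB rmorphM /= -!pmulrn We.
have WeZ' : (W N L t)%:Z - (W N L t')%:Z = (p ^ i)%N%:Z * e'.
  by apply/eqP; rewrite -(eqr_int rat) rmorphB rmorphM /= -!pmulrn We'.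
apply/eqP; rewrite -eqz_nat -!modz_nat eqz_mod_dvd.
have -> : (q * W N L (a g) + W N L t)%N%:Z - (q * W N L (a g') + W N L t')%N%:Z =
    (p ^ i)%N%:Z * (q%:Z * e + e').
  rewrite !PoszD !PoszM mulrDr mulrCA -WeZ -WeZ'; ring.
exact: dvdz_mull.
Qed.

(** Residues of [T] inject into codes for the complement of [I]. Both numbers, multiplied by the
    number of codes for [I], give [p ^ L], so every code occurs. *)
Lemma exact_tiling_tree : tree (~` I) T.
Proof.
have oT := exact_tiling_ord.
apply: (@tree_of_codes _ _ (~` I) T n0 (Num.min M n0)) => //.
  by move=> j nI; rewrite ltNge; apply/negP => n0j; apply: nI; exact: (order_level tO On0).
move=> N NMn g; have NM : N <= M by lia.
set L := `|(n0 - N)%R|%N in g *; have LE : n0 = N + L%:Z by rewrite /L; lia.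
have [a aP] := Om_reps L NM; have [r rP] := residue_reps N L.
have card1 := tiling_card NM LE aP rP.
have card2 : (#|{: codes p N L I}| * #|{: codes p N L (~` I)}| = p ^ L)%N.
  rewrite !card_ffun card_ord -expnD !card_sig -[in RHS](card_ord L).
  rewrite -(cardC (fun i : 'I_L => `[< I (N + i%:Z) >])); congr (p ^ (_ + _))%N.
  by apply: eq_card => i; rewrite !inE asbool_neg.
have cardE : #|{: codes p N L (~` I)}| = #|{: residues N L}|.
  apply/eqP; rewrite -(eqn_pmul2l (m := #|{: codes p N L I}|)) ?card1 ?card2 //.
  by apply/card_gt0P; exists [ffun=> Ordinal p_gt0].
pose f (b : residues N L) := dcode N L (~` I) (r b).
have finj : injective f.
  move=> b b' e; have [Tb Nb Wb] := rP b; have [Tb' Nb' Wb'] := rP b'.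
  apply/val_inj/val_inj; rewrite /= -Wb -Wb'; apply: W_agree.
  exact: (code_inj oT).
have [h _ fh] := inj_card_bij finj (eq_leq cardE).
by have [Tb Nb _] := rP (h g); exists (r (h g)); split=> //; exact: fh.
Qed.

End ExactIsTree.

Lemma tilingP (T : set QPm) : tiling_complement m Om T <-> tree (~` I) T.
Proof.
rewrite tiling_complementP; split; [exact: exact_tiling_tree|exact: tree_exact_tiling].
Qed.

End Tiling.

(** * Assembly: both parts from the characterization of trees *)

Theorem theorem1p2 (p : nat) (hp : prime p) (R : realType)
  (m : {measure set (QPm (prime_gt0 hp)) -> \bar R})
  (Hm : haar_measure m)
  (Om : set (QPm (prime_gt0 hp)))
  (Hcompact : qp_compact Om) (Hopen : qp_open Om)
  (Hhom : p_homogeneous Om) (Hpos : (0 < m Om)%E) :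
  (spectrum m Om (Lambda0 Om)
   /\ forall Lam : set (QPm (prime_gt0 hp)),
        spectrum m Om Lam <->
        exists f, isometric_bijection f /\ Lam = f @` Lambda0 Om)
  /\
  (tiling_complement m Om (T0 Om)
   /\ forall T : set (QPm (prime_gt0 hp)),
        tiling_complement m Om T <->
        exists f, isometric_bijection f /\ T = f @` T0 Om).
Proof.
have p_gt1 := prime_gt1 hp.
have O0 : Om !=set0.
  by apply/set0P; apply: contraTneq Hpos => ->; rewrite measure0 ltxx.
have [M OM] := qp_compact_bounded p_gt1 Hcompact.
have [n0 On0] := qp_compact_open_level p_gt1 Hcompact Hopen.
have tO := homogeneous_tree p_gt1 Hhom O0.
set I := adm_orders Om in tO.
(* Both sets of orders are bounded above, [J] because [Om] is bounded and the complement of [I]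
   because [Om] is open at level [n0]; this makes [Lambda0] and [T0] the model trees. *)
have Jb j : dual_orders I j -> j < - M := dual_order_lt tO OM (j := j).
have Ib j : (~` I) j -> j < n0.
  by move=> nI; rewrite ltNge; apply/negP => n0j; apply: nI; exact: (order_level tO On0).
have LE : Lambda0 Om = @suppset p (prime_gt0 hp) (dual_orders I).
  by apply: (@digit_sumsetE _ _ _ _ (- M)) => // j; lia.
have TE : T0 Om = @suppset p (prime_gt0 hp) (~` I).
  by apply: (@digit_sumsetE _ _ _ _ n0).
have id_iso : isometric_bijection (@id (QP_ (prime_gt0 hp))) by split=> //; exists id.
have isoP (J : set int) (b : int) (S : set (QPm (prime_gt0 hp))) : (forall j, J j -> j < b) ->
    tree J S <-> exists f, isometric_bijection f /\ S = f @` suppset J.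
  move=> Jlt; split=> [tS|[f [fiso ->]]]; first exact: (tree_isometric_image p_gt1 Jlt tS).
  exact: isometric_image_tree.
rewrite LE TE; split; split.
- apply/(spectrumP Hm tO OM On0)/(isoP _ _ _ Jb).
  by exists id; split; rewrite ?image_id.
- by move=> Lam; rewrite (spectrumP Hm tO OM On0); exact: isoP Jb.
- apply/(tilingP Hm tO OM On0)/(isoP _ _ _ Ib).
  by exists id; split; rewrite ?image_id.
- by move=> T; rewrite (tilingP Hm tO OM On0); exact: isoP Ib.
Qed.
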